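(* Let $\Lambda\subset\mathbb N$. Suppose there exist constants $C>0$ and $\alpha\ge 1/2$ such that $$\|f\|_q\le C\,q^{\alpha}\,\|f\|_2\qquad\text{for all } q>2 \text{ and all } f\in\mathcal P_\Lambda .$$ Then $\Lambda$ is $p$-Rider for $p=\dfrac{4\alpha}{2\alpha+1}$.
   Context: $\mathbb N=\{1,2,\ldots\}$, $\mathbb T=\mathbb R/\mathbb Z$ with Lebesgue (Haar probability) measure $m$, $e_k(x)=e^{2i\pi kx}$, and $\|\cdot\|_q$ is the norm of $L^q(\mathbb T,m)$. $\mathcal P_\Lambda$ is the set of trigonometric polynomials $f=\sum_{k\in\Lambda}a_ke_k$ (finite sums, complex coefficients) with spectrum in $\Lambda$; $\widehat f(k)=a_k$. If $(\varepsilon_k)$ is a Rademacher sequence (i.i.d., values $\pm1$ with probability $1/2$), put $f_\omega=\sum_k\varepsilon_k(\omega)a_ke_k$ and $[f]=\mathbb E(\|f_\omega\|_\infty)$ (the Pisier norm). For $1\le p<2$, a set $\Lambda\subset\mathbb N$ is called $p$-Rider if there is a constant $C'$ such that $\big(\sum_k|\widehat f(k)|^p\big)^{1/p}\le C'[f]$ for every $f\in\mathcal P_\Lambda$. *)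

(* Defs.v *)
From HB Require Import structures.
From mathcomp Require Import all_boot all_order all_algebra finmap complex.
From mathcomp Require Import all_classical all_reals all_analysis.

Set Implicit Arguments.
Unset Strict Implicit.
Unset Printing Implicit Defensive.

Import Order.TTheory GRing.Theory Num.Theory numFieldNormedType.Exports.

Local Open Scope classical_set_scope.
Local Open Scope ring_scope.

(* The torus R/Z is identified with its fundamental domain [0, 1[: a function
   on the torus is a 1-periodic function on R, and the Haar probability measure
   is the restriction of Lebesgue measure to [0, 1[. *)
Definition haar (R : realType) : {measure set (measurableTypeR R) -> \bar R} :=
  mrestr (@lebesgue_measure R) (measurable_itv `[0 : R, 1[).

Definition char (R : realType) (k : nat) (x : R) : R[i] :=
  (cos (2 * pi * k%:R * x) +i* sin (2 * pi * k%:R * x))%C.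

(* A trigonometric polynomial is represented by its finitely supported family
   of Fourier coefficients. *)
Definition coefs (R : realType) := {fsfun nat -> R[i] with 0}.

Definition trigpoly (R : realType) (a : coefs R) (x : R) : R[i] :=
  \sum_(k <- finsupp a) a k * char k x.

Definition spectrum_in (R : realType) (L : set nat) (a : coefs R) : Prop :=
  [set` finsupp a] `<=` L.

(* For q = +oo this is the essential supremum of |f|. *)
Definition Lqnorm (R : realType) (q : \bar R) (f : R -> R[i]) : \bar R :=
  Lnorm (haar R) q (fun x => (Normc.normc (f x))%:E).

Definition mutually_independent d (T : measurableType d) (R : realType)
    (P : probability T R) (I : set nat) (X : nat -> T -> R) : Prop :=
  forall (J : {fset nat}) (B : nat -> set R),
    [set` J] `<=` I -> (forall k, measurable (B k)) ->
    P (\bigcap_(k in [set` J]) X k @^-1` B k) =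
    (\prod_(k <- J) P (X k @^-1` B k))%E.

(* The sequence is indexed by k >= 1; the variable eps 0 is irrelevant. *)
Definition rademacher d (T : measurableType d) (R : realType)
    (P : probability T R) (eps : nat -> {RV P >-> R}) : Prop :=
  (forall k, (0 < k)%N ->
     P (eps k @^-1` [set 1]) = (2^-1)%:E /\
     P (eps k @^-1` [set -1]) = (2^-1)%:E) /\
  mutually_independent P [set k | (0 < k)%N] (fun k => eps k).

Definition pisier_norm d (T : measurableType d) (R : realType)
    (P : probability T R) (eps : nat -> {RV P >-> R}) (a : coefs R) : \bar R :=
  (\int[P]_w Lqnorm +oo
     (fun x => \sum_(k <- finsupp a) (eps k w)%:C%C * a k * char k x)%R)%E.

Definition rider d (T : measurableType d) (R : realType)
    (P : probability T R) (eps : nat -> {RV P >-> R}) (p : R) (L : set nat) :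
    Prop :=
  exists C' : R, forall a : coefs R, spectrum_in L a ->
    (((\sum_(k <- finsupp a) Normc.normc (a k) `^ p) `^ p^-1)%:E
       <= C'%:E * pisier_norm eps a)%E.

(* Main.v *)
(* Sort the coefficients of a polynomial f with spectrum in L by decreasing
   modulus into dyadic blocks A_j of 2^j frequencies on which they are at least
   b_j. On the grid t/(M+1) the characters live on a finite cyclic group, on
   which D_j(t) = sum_(k in A_j) |e_k(t) - 1|^2 is a translation-invariant
   squared distance up to constants. For even q and large M, the q-th moments
   are grid averages, so that the hypothesis bounds the proportion of the t with
   D_j(t) <= 2^j by exp(- g_j), where g_j is of order 2^(j/(2 alpha)).

   A point at which the random polynomial is large is reached in stages, one
   block at a time, the move of stage j being drawn from the Gibbs measure of
   density proportional to exp(lambda * (contribution of A_j)). Flipping one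
   sign writes the mean of this contribution as a covariance, and the Gibbs
   variational principle forces the measure to spread over a D_j-distance r at
   which the balls still have entropy N: the stage gains about
   min(r, sqrt(r N)). Later moves must not spoil this, hence are confined to a
   set which is D_i-small for all earlier blocks i; pigeonholing over translates
   of balls shows that this set is large enough as soon as the entropies are
   well separated. Since g_j grows geometrically, a greedy choice of separated
   blocks loses only a constant factor.

   Altogether sum_j b_j sqrt(2^j g_j) is at most a constant times [f], and
   sqrt(2^j g_j) is of order 2^(j/p); Cauchy condensation concludes. *)

Require Import Defs.
From mathcomp Require Import all_boot all_order all_algebra finmap complex.
From mathcomp Require Import all_classical all_reals all_analysis.
From mathcomp Require Import measurable_realfun ess_sup_inf.
From mathcomp Require Import ring lra zify.

Import Order.TTheory GRing.Theory Num.Theory numFieldNormedType.Exports.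

Set Implicit Arguments.
Unset Strict Implicit.
Unset Printing Implicit Defensive.

Local Open Scope ring_scope.

(** * Averages and expectations *)

Section Avg.
Context {R : realType}.

Definition avg (T : finType) (F : T -> R) : R := #|T|%:R^-1 * \sum_x F x.

Lemma avg_le (T : finType) (F G : T -> R) :
  (forall x, F x <= G x) -> avg F <= avg G.
Proof. by move=> FG; rewrite ler_wpM2l ?invr_ge0 ?ler0n // ler_sum. Qed.

Lemma avgD (T : finType) (F G : T -> R) :
  avg (fun x => F x + G x) = avg F + avg G.
Proof. by rewrite /avg big_split mulrDr. Qed.

Lemma avgZ (T : finType) c (F : T -> R) : avg (fun x => c * F x) = c * avg F.
Proof. by rewrite /avg -mulr_sumr mulrCA. Qed.

Lemma avg_sum (T I : finType) (A : pred I) (F : I -> T -> R) :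
  avg (fun x => \sum_(i | A i) F i x) = \sum_(i | A i) avg (F i).
Proof. by rewrite /avg exchange_big mulr_sumr. Qed.

Lemma avg_cst (T : finType) c : (0 < #|T|)%N -> avg (fun _ : T => c) = c.
Proof.
move=> T0; rewrite /avg sumr_const -[c *+ _]mulr_natl mulKf //.
by rewrite pnatr_eq0 -lt0n.
Qed.

Lemma avg_ge0 (T : finType) (F : T -> R) : (forall x, 0 <= F x) -> 0 <= avg F.
Proof. by move=> F0; rewrite mulr_ge0 ?invr_ge0 ?ler0n // sumr_ge0. Qed.

Lemma avg_reindex (T : finType) (h : T -> T) (F : T -> R) :
  injective h -> avg F = avg (F \o h).
Proof. by move=> hI; rewrite /avg (reindex_inj hI). Qed.

Lemma eq_avg (T : finType) (F G : T -> R) : F =1 G -> avg F = avg G.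
Proof. by move=> FG; rewrite /avg (eq_bigr _ (fun i _ => FG i)). Qed.

Definition is_prob (G : finType) (mu : G -> R) :=
  (forall t, 0 <= mu t) /\ \sum_t mu t = 1.

Definition ex (G : finType) (mu f : G -> R) := \sum_t mu t * f t.
Definition ex2 (G : finType) (mu : G -> R) (f : G -> G -> R) :=
  ex mu (fun t => ex mu (f t)).

Section Ex.
Variables (G : finType) (mu : G -> R).
Hypothesis mu1 : is_prob mu.

Lemma ex_le f g : (forall t, mu t != 0 -> f t <= g t) -> ex mu f <= ex mu g.
Proof.
move=> fg; apply: ler_sum => t _; have [->|m0] := eqVneq (mu t) 0.
  by rewrite !mul0r.
by rewrite ler_wpM2l ?fg // mu1.1.
Qed.

Lemma exD f g : ex mu (fun t => f t + g t) = ex mu f + ex mu g.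
Proof. by rewrite /ex -big_split; apply: eq_bigr => t _; rewrite mulrDr. Qed.

Lemma exZ c f : ex mu (fun t => c * f t) = c * ex mu f.
Proof. by rewrite /ex mulr_sumr; apply: eq_bigr => t _; rewrite mulrCA. Qed.

Lemma exB f g : ex mu (fun t => f t - g t) = ex mu f - ex mu g.
Proof.
rewrite -[X in _ - X]mul1r -mulNr -exZ -exD.
by apply: eq_bigr => t _; rewrite mulN1r.
Qed.

Lemma ex_cst c : ex mu (fun => c) = c.
Proof. by rewrite /ex -mulr_suml mu1.2 mul1r. Qed.

Lemma ex_sum (I : finType) (A : pred I) (F : I -> G -> R) :
  ex mu (fun t => \sum_(i | A i) F i t) = \sum_(i | A i) ex mu (F i).
Proof.
rewrite /ex exchange_big; apply: eq_bigr => t _ /=.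
by rewrite mulr_sumr.
Qed.

Lemma eq_ex f g : f =1 g -> ex mu f = ex mu g.
Proof. by move=> fg; apply: eq_bigr => t _; rewrite fg. Qed.

Lemma ex_exchange f : ex mu (fun t => ex mu (f t)) = ex mu (fun t' => ex mu (f^~ t')).
Proof.
rewrite /ex; under eq_bigr do rewrite mulr_sumr.
rewrite exchange_big; apply: eq_bigr => t _; rewrite mulr_sumr.
by apply: eq_bigr => t' _ /=; rewrite mulrCA.
Qed.

Lemma ex_ge0 f : (forall t, 0 <= f t) -> 0 <= ex mu f.
Proof. by move=> f0; apply: sumr_ge0 => t _; rewrite mulr_ge0 // mu1.1. Qed.

Lemma ex2_le f g : (forall s t, f s t <= g s t) -> ex2 mu f <= ex2 mu g.
Proof. by move=> fg; apply: ex_le => t _; apply: ex_le. Qed.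

Lemma ex2D f g : ex2 mu (fun s t => f s t + g s t) = ex2 mu f + ex2 mu g.
Proof. by rewrite /ex2 -exD; apply: eq_ex => t; rewrite exD. Qed.

Lemma ex2Z c f : ex2 mu (fun s t => c * f s t) = c * ex2 mu f.
Proof. by rewrite /ex2 -exZ; apply: eq_ex => t; rewrite exZ. Qed.

Lemma ex2_sum (I : finType) (A : pred I) (F : I -> G -> G -> R) :
  ex2 mu (fun s t => \sum_(i | A i) F i s t) = \sum_(i | A i) ex2 mu (F i).
Proof. by rewrite /ex2 -ex_sum; apply: eq_ex => t; rewrite ex_sum. Qed.

Lemma ex2_ge0 f : (forall s t, 0 <= f s t) -> 0 <= ex2 mu f.
Proof. by move=> f0; apply: ex_ge0 => t; apply: ex_ge0. Qed.

(** The left side is twice the variance of [e] under [mu]. *)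
Lemma ex2_diff_sq e :
  ex2 mu (fun s t => (e s - e t) ^+ 2) <= 2 * ex mu (fun t => e t ^+ 2).
Proof.
have -> : ex2 mu (fun s t => (e s - e t) ^+ 2) =
  2 * ex mu (fun t => e t ^+ 2) - 2 * ex mu e ^+ 2.
  transitivity (ex mu (fun s => e s ^+ 2 + - 2 * ex mu e * e s + ex mu (fun t => e t ^+ 2))).
    apply: eq_ex => s.
    transitivity (ex mu (fun t => e s ^+ 2 + - 2 * e s * e t + e t ^+ 2)).
      by apply: eq_ex => t; ring.
    by rewrite !exD ex_cst exZ; ring.
  by rewrite !exD exZ ex_cst; ring.
by rewrite lerBlDr lerDl mulr_ge0 // sqr_ge0.
Qed.

(** Symmetrised form of a covariance: it reduces bounds on the covariance to pointwise bounds on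
    products of increments. *)
Lemma ex2_cov (Y w : G -> R) :
  ex2 mu (fun s t => (Y s - Y t) * (w t - w s)) =
  2 * (ex mu Y * ex mu w - ex mu (fun t => Y t * w t)).
Proof.
transitivity (ex mu (fun s => Y s * ex mu w + - 1 * (Y s * w s)
    + - 1 * ex mu (fun t => Y t * w t) + ex mu Y * w s)).
  apply: eq_ex => s.
  transitivity (ex mu (fun t => Y s * w t + - 1 * (Y s * w s) +
      - 1 * (Y t * w t) + w s * Y t)).
    by apply: eq_ex => t; ring.
  by rewrite !exD !exZ !ex_cst; ring.
rewrite !exD !exZ !ex_cst.
have -> : ex mu (fun s => Y s * ex mu w) = ex mu Y * ex mu w.
  by rewrite mulrC -exZ; apply: eq_ex => t; rewrite mulrC.
by ring.
Qed.

End Ex.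

Lemma expR_quarter (x : R) : `|x| <= 4^-1 -> 3 / 4 <= expR x <= 4 / 3.
Proof.
rewrite ler_norml => /andP[x1 x2].
have h1 := expR_ge1Dx x; have h2 := expR_ge1Dx (- x).
have e0 := expR_gt0 x.
have : expR x * expR (- x) = 1 by rewrite expRN divff // gt_eqF.
by move=> h; apply/andP; split; nra.
Qed.

(** Each exponential lies above its tangent line at the other point, and both slopes are in the
    range of [expR_quarter]. *)
Lemma expR_diff (x y : R) : `|x| <= 4^-1 -> `|y| <= 4^-1 -> x <= y ->
  3 / 4 * (y - x) <= expR y - expR x <= 4 / 3 * (y - x).
Proof.
move=> hx hy xy.
have /andP[a1 a2] := expR_quarter hx; have /andP[b1 b2] := expR_quarter hy.
have h1 := expR_ge1Dx (y - x); have h2 := expR_ge1Dx (x - y).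
rewrite !expRD in h1 h2.
have ex0 := expR_gt0 x; have ey0 := expR_gt0 y.
have : expR x * expR (- x) = 1 by rewrite expRN divff // gt_eqF.
have : expR y * expR (- y) = 1 by rewrite expRN divff // gt_eqF.
have := expR_gt0 (- x); have := expR_gt0 (- y).
move: (expR (- x)) (expR (-y)) h1 h2 => p q h1 h2 q0 p0 hq hp.
have k1 : expR x * (1 + (y - x)) <= expR y by nra.
have k2 : expR y * (1 + (x - y)) <= expR x by nra.
by apply/andP; split; nra.
Qed.

(** The increment [q] of the flip weights has the sign of [x - x'] and a size between 3/2 and 8/3
    times [lam * |x - x'|]. The perturbation [e] then costs only the square of its own increment. *)
Lemma tilt_pointwise (lam x x' e e' : R) : 0 <= lam -> lam <= 8^-1 ->
  `|x| <= 1 -> `|x'| <= 1 ->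
  let q := expR (- (2 * lam * x')) - expR (- (2 * lam * x)) in
  lam * ((x - x') ^+ 2 - 4 * (e - e') ^+ 2) <= ((x + e) - (x' + e')) * q /\
  (x - x') * q <= 8 / 3 * lam * (x - x') ^+ 2.
Proof.
move=> l0 l8 hx hx' q.
(* Exchanging the two points changes the sign of every increment, [q] included, so the products are
   unchanged. *)
wlog xx' : x x' e e' hx hx' @q / x' <= x.
  move=> H; have [|/ltW] := lerP x' x; first exact: H.
  move=> /(H x' x e' e hx' hx); rewrite {}/q.
  set a := expR _; set b := expR _ => -[H1 H2]; split; nra.
have n1 : `|- (2 * lam * x')| <= 4^-1.
  rewrite normrN !normrM (ger0_norm l0) ger0_norm //; nra.
have n2 : `|- (2 * lam * x)| <= 4^-1.
  rewrite normrN !normrM (ger0_norm l0) ger0_norm //; nra.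
have /andP[q1 q2] := expR_diff n2 n1 ltac:(nra).
rewrite -/q in q1 q2.
split; last by nra.
have d0 : 0 <= x - x' by lra.
set d := x - x' in q1 q2 d0 *.
have -> : x + e - (x' + e') = d + (e - e') by rewrite /d; ring.
have {}q1 : 3/2 * (lam * d) <= q by rewrite /d; nra.
have {}q2 : q <= 8/3 * (lam * d) by rewrite /d; nra.
set h := e - e'.
have p0 : 0 <= lam * d by nra.
suff: lam * (d ^+ 2 - 4 * h ^+ 2) <= d * (3/2 * (lam * d)) - `|h| * (8/3 * (lam * d)).
  move=> /le_trans; apply; have := ler_norm (- h); have := ler_norm h; rewrite normrN.
  have := normr_ge0 h; move: (`|h|) => m; nra.
rewrite -(real_normK (num_real h)); have := normr_ge0 h; move: (`|h|) => m m0.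
(* The bracket is half of [(d - 8/3 * m) ^+ 2] plus [4/9 * m ^+ 2]. *)
have : 0 <= lam * (2^-1 * d ^+ 2 - 8/3 * m * d + 4 * m ^+ 2).
  by apply: mulr_ge0 => //; have := sqr_ge0 (d - 8/3 * m); have := sqr_ge0 m; nra.
nra.
Qed.

End Avg.

(** * Gibbs measures and the gain of one stage *)

Section Gibbs.
Context {R : realType} (G : finType).
Implicit Types (T E : {set G}) (F g : G -> R).

Definition gibbs T F (t : G) : R :=
  if t \in T then expR (F t) / \sum_(u in T) expR (F u) else 0.

Lemma gibbs_sum_gt0 T F : T != finset.set0 -> 0 < \sum_(u in T) expR (F u).
Proof.
case/finset.set0Pn => t tT; rewrite (bigD1 t) //= ltr_pwDl ?expR_gt0 //.
by apply: sumr_ge0 => u _; rewrite expR_ge0.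
Qed.

Lemma gibbs_prob T F : T != finset.set0 -> is_prob (gibbs T F).
Proof.
move=> T0; have Z0 := gibbs_sum_gt0 F T0; split=> [t|].
  by rewrite /gibbs; case: ifP => // _; rewrite divr_ge0 ?expR_ge0 ?ltW.
by rewrite /gibbs -big_mkcond -mulr_suml divff // gt_eqF.
Qed.

Lemma ex_gibbs T F h : ex (gibbs T F) h =
  (\sum_(t in T) expR (F t) * h t) / \sum_(u in T) expR (F u).
Proof.
rewrite /ex [LHS](bigID (mem T)) /= [X in _ + X]big1 ?addr0; last first.
  by move=> t /negbTE tT; rewrite /gibbs tT mul0r.
by rewrite mulr_suml; apply: eq_bigr => t tT; rewrite /gibbs tT mulrAC.
Qed.

Lemma gibbs_tilt T F g t : T != finset.set0 ->
  gibbs T (fun u => F u + g u) t =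
  gibbs T F t * expR (g t) / ex (gibbs T F) (expR \o g).
Proof.
move=> T0; have Z0 := gibbs_sum_gt0 F T0.
rewrite ex_gibbs /gibbs; case: ifP => _; last by rewrite !mul0r.
under eq_bigr do rewrite expRD.
rewrite /= expRD; field.
rewrite (gt_eqF Z0) /= gt_eqF //; under eq_bigr do rewrite -expRD.
exact: gibbs_sum_gt0 (fun u => F u + g u) T0.
Qed.

Lemma ex_tilt T F g (Y : G -> R) : T != finset.set0 ->
  ex (gibbs T (fun u => F u + g u)) Y =
  ex (gibbs T F) (fun t => Y t * expR (g t)) / ex (gibbs T F) (expR \o g).
Proof.
move=> T0; rewrite {1}/ex; under eq_bigr do rewrite gibbs_tilt //.
by rewrite mulr_suml; apply: eq_bigr => t _ /=; ring.
Qed.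

(** The new weight is at most 4/3 and the normalisation at least 3/4; the ratio 16/9 is below 2. *)
Lemma gibbs_tilt_le T F g t : T != finset.set0 -> (forall u, `|g u| <= 4^-1) ->
  gibbs T (fun u => F u + g u) t <= 2 * gibbs T F t.
Proof.
move=> T0 g4; have mP := gibbs_prob F T0; rewrite gibbs_tilt //.
have e1 : 3 / 4 <= ex (gibbs T F) (expR \o g).
  rewrite -[leLHS](ex_cst mP); apply: (ex_le mP) => u _ /=.
  by have /andP[] := expR_quarter (g4 u).
have /andP[_ e2] := expR_quarter (g4 t).
rewrite ler_pdivrMr; last by apply: lt_le_trans e1; lra.
have m0 := mP.1 t; nra.
Qed.

(* The Gibbs variational principle, tested against [N * 1_E]. *)
Lemma gibbs_concentration T E F (N : R) : T != finset.set0 ->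
  #|T :&: E|%:R <= expR (- N) * #|T|%:R ->
  N * ex (gibbs T F) (fun t => (t \in E)%:R)
    + ln ((\sum_(u in T) expR (F u)) / #|T|%:R) - ln 2 <= ex (gibbs T F) F.
Proof.
move=> T0 TE; have Z0 := gibbs_sum_gt0 F T0; have mP := gibbs_prob F T0.
have c0 : 0 < #|T|%:R :> R by rewrite ltr0n card_gt0.
set Z := \sum_(u in T) _ in Z0 *; rewrite -addrA; set L := ln _ - ln 2.
rewrite -(ex_cst mP L) -exZ -exD -subr_le0 -exB.
(* Since [y <= expR y - 1], it suffices that [expR y] has mean at most 1. There [expR (- F)] cancels
   the Gibbs density, and a uniform mean of [expR (N * 1_E)] over [T] remains: [E] and its
   complement contribute at most 1 each, which is the 2 in [ln 2]. *)
pose y t := N * (t \in E)%:R + L - F t.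
rewrite -[ex _ _]/(ex (gibbs T F) y).
apply: (@le_trans _ _ (ex (gibbs T F) (fun t => expR (y t) - 1))).
  by apply: (ex_le mP) => t _; rewrite lerBrDl expR_ge1Dx.
rewrite exB ex_cst // subr_le0.
have eL : expR L = Z / #|T|%:R / 2.
  by rewrite expRB !lnK // posrE ?divr_gt0.
have -> : ex (gibbs T F) (fun t => expR (y t)) =
    (\sum_(t in T) expR (N * (t \in E)%:R)) / (2 * #|T|%:R).
  rewrite ex_gibbs !mulr_suml; apply: eq_bigr => t tT; rewrite /y expRB expRD eL.
  rewrite -/Z; field.
  by rewrite !gt_eqF ?expR_gt0.
rewrite ler_pdivrMr ?mulr_gt0 // mul1r.
rewrite (bigID (mem E)) /=.
under eq_bigr => t /andP[_ tE] do rewrite tE mulr1.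
under [X in _ + X]eq_bigr => t /andP[_ /negbTE tE] do rewrite tE mulr0 expR0.
rewrite !sumr_const mulr2n mulrDl !mul1r lerD //; last first.
  by rewrite ler_nat subset_leq_card //; apply/fintype.subsetP => t /andP[].
rewrite -(mulr_natr (expR N)).
have -> : #|(fun i => (i \in T) && (i \in E))| = #|T :&: E|.
  by apply: eq_card => t; rewrite !inE.
apply: le_trans (ler_wpM2l (expR_ge0 N) TE) _.
by rewrite mulrA -expRD subrr expR0 mul1r.
Qed.

(** Jensen's inequality, from the tangent line of the exponential at the mean [c]. *)
Lemma gibbs_jensen T F : T != finset.set0 ->
  (\sum_(t in T) F t) / #|T|%:R <= ln ((\sum_(u in T) expR (F u)) / #|T|%:R).
Proof.
move=> T0; have Z0 := gibbs_sum_gt0 F T0.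
have c0 : 0 < #|T|%:R :> R by rewrite ltr0n card_gt0.
set c := (\sum_(t in T) F t) / _.
rewrite -[leLHS]expRK ler_ln ?posrE ?expR_gt0 ?divr_gt0 //.
rewrite ler_pdivlMr // -ler_pdivlMl ?expR_gt0 // -expRN mulr_sumr.
apply: (@le_trans _ _ (\sum_(t in T) (1 + (F t - c)))).
  rewrite big_split /= sumrB !sumr_const -[c *+ _]mulr_natr /c divfK ?gt_eqF //.
  by rewrite subrr addr0.
apply: ler_sum => t _; rewrite -expRD [_ + F t]addrC; exact: expR_ge1Dx.
Qed.

End Gibbs.

(** * Random signs and the gain of a single stage *)

Section Stage.
Context {R : realType} (G K : finType) (C S : K -> G -> R).
Hypothesis C1 : forall k t, `|C k t| <= 1.
Hypothesis S1 : forall k t, `|S k t| <= 1.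

(* The sign is [w.1]; [w.2] selects the imaginary part rather than the real one. *)
Definition signed_part (w : bool * bool) (c s : R) : R :=
  (-1) ^+ w.1 * (if w.2 then s else c).

Definition flips (k : K) (w : {ffun K -> bool * bool}) : {ffun K -> bool * bool} :=
  [ffun i => if i == k then (~~ (w i).1, (w i).2) else w i].

Definition flipc (k : K) (w : {ffun K -> bool * bool}) : {ffun K -> bool * bool} :=
  [ffun i => if i == k then ((w i).1, ~~ (w i).2) else w i].

Lemma flips_inj k : injective (flips k).
Proof.
apply: (can_inj (g := flips k)) => w; apply/ffunP => i; rewrite !ffunE.
by case: eqP => // _; rewrite negbK; case: (w i).
Qed.

Lemma flipc_inj k : injective (flipc k).
Proof.
apply: (can_inj (g := flipc k)) => w; apply/ffunP => i; rewrite !ffunE.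
by case: eqP => // _; rewrite negbK; case: (w i).
Qed.

Lemma signed_part_flips k w c s : signed_part (flips k w k) c s = - signed_part (w k) c s.
Proof.
by rewrite /signed_part ffunE eqxx; case: (w k) => -[] b /=; rewrite ?expr1 ?expr0 ?mulN1r ?mul1r ?opprK.
Qed.

Lemma signed_part_flips_neq i k w c s : i != k ->
  signed_part (flips k w i) c s = signed_part (w i) c s.
Proof. by move=> /negbTE ik; rewrite ffunE ik. Qed.

Lemma signed_part_flipc_neq i k w c s : i != k ->
  signed_part (flipc k w i) c s = signed_part (w i) c s.
Proof. by move=> /negbTE ik; rewrite ffunE ik. Qed.

Lemma signed_part_sq w c s : signed_part w c s ^+ 2 = (if w.2 then s else c) ^+ 2.
Proof. by rewrite exprMn sqrr_sign mul1r. Qed.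

Lemma signed_part_flipc_sq k (w : {ffun K -> bool * bool}) c s :
  signed_part (w k) c s ^+ 2 + signed_part (flipc k w k) c s ^+ 2 = c ^+ 2 + s ^+ 2.
Proof.
by rewrite !signed_part_sq ffunE eqxx /=; case: (w k).2 => /=; rewrite // addrC.
Qed.

Lemma signed_partB w c s c' s' :
  signed_part w c s - signed_part w c' s' = signed_part w (c - c') (s - s').
Proof. by rewrite /signed_part -mulrBr; case: w.2. Qed.

Lemma signed_part_le1 w c s : `|c| <= 1 -> `|s| <= 1 -> `|signed_part w c s| <= 1.
Proof. by rewrite /signed_part normrM normr_sign mul1r; case: w.2. Qed.

Definition coord (w : {ffun K -> bool * bool}) k t := signed_part (w k) (C k t) (S k t).

(** In the application [(C k t, S k t)] runs through the unit circle, and this is |e_k(t) -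
    e_k(t')|^2. *)
Definition dist2 k t t' := (C k t - C k t') ^+ 2 + (S k t - S k t') ^+ 2.

Variables (A : {set K}) (T : {set G}).
Hypothesis T0 : T != finset.set0.
Variable lam : R.
Hypotheses (lam0 : 0 <= lam) (lam8 : lam <= 8^-1).

Definition energy (w : {ffun K -> bool * bool}) t := lam * \sum_(k in A) coord w k t.
Notation mu w := (gibbs T (energy w)).

Lemma coord_le1 w k t : `|coord w k t| <= 1.
Proof. exact: signed_part_le1. Qed.

Lemma energy_flips k w t : k \in A ->
  energy (flips k w) t = energy w t + - (2 * lam * coord w k t).
Proof.
move=> kA; rewrite /energy (bigD1 k) //= [in RHS](bigD1 k) //=.
rewrite (eq_bigr (fun i => coord w i t)); last first.
  by move=> i /andP[_ ik]; rewrite /coord signed_part_flips_neq.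
by rewrite {1}/coord signed_part_flips -/(coord w k t); ring.
Qed.

Lemma energy_flipc k w t : k \in A ->
  energy (flipc k w) t = energy w t + lam * (coord (flipc k w) k t - coord w k t).
Proof.
move=> kA; rewrite /energy (bigD1 k) //= [in RHS](bigD1 k) //=.
rewrite (eq_bigr (fun i => coord w i t)); last first.
  by move=> i /andP[_ ik]; rewrite /coord signed_part_flipc_neq.
by ring.
Qed.

(** The factor by which flipping the k-th sign multiplies the unnormalised Gibbs density. *)
Definition tilt k w t := expR (- (2 * lam * coord w k t)).

Lemma tilt_quarter k w t : `|- (2 * lam * coord w k t)| <= 4^-1.
Proof.
rewrite normrN normrM (normrM 2 lam) (ger0_norm lam0) ger0_norm //.
have := coord_le1 w k t; have := normr_ge0 (coord w k t); set x := `|coord w k t| => x0 x1.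
have : lam * x <= 8^-1 * 1 by apply: ler_pM.
lra.
Qed.

Lemma tilt_mean k w : 3 / 4 <= ex (mu w) (tilt k w) <= 4 / 3.
Proof.
have mP := gibbs_prob (energy w) T0.
apply/andP; split; rewrite -[leLHS](ex_cst mP) ?[X in _ <= X](ex_cst mP).
  by apply: (ex_le mP) => t _; have /andP[] := expR_quarter (tilt_quarter k w t).
rewrite -[leRHS](ex_cst mP); rewrite ex_cst //.
by apply: (ex_le mP) => t _; have /andP[] := expR_quarter (tilt_quarter k w t).
Qed.

Section Gain.
Variables (k : K) (y1 y2 : G -> R).
Hypothesis kA : k \in A.

(** In the application [y1] and [y2] are [C k] and [S k] averaged over the moves of later stages. *)
Let Y w t := signed_part (w k) (y1 t) (y2 t).
Notation tilt := (tilt k).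

(* Flipping the sign of the k-th variable turns the mean of [Y] into a covariance. *)
Lemma gain_flip : avg (fun w => ex (mu w) (Y w)) =
  avg (fun w => ex2 (mu w)
     (fun s t => (Y w s - Y w t) * (tilt w t - tilt w s)) / (4 * ex (mu w) (tilt w))).
Proof.
(* Average [w] with its flip: [Y] changes sign and [mu w] is reweighted by [tilt]. The half taken
   here and the 2 of [ex2_cov] give the 4 in the denominator. *)
set L := LHS; have -> : L = 2^-1 * (L + L) by lra.
rewrite {2}/L (avg_reindex _ (@flips_inj k)) {}/L -avgD -avgZ; apply: eq_avg => w /=.
have -> : mu (flips k w) = gibbs T (fun t => energy w t + - (2 * lam * coord w k t)).
  by congr gibbs; apply/funext => t; exact: energy_flips.
rewrite (@ex_tilt _ _ T (energy w) (fun t => - (2 * lam * coord w k t)) _ T0) (ex2_cov (gibbs_prob (energy w) T0) (Y w) (tilt w)).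
have -> : ex (mu w) (fun t => Y (flips k w) t * expR (- (2 * lam * coord w k t))) =
   - ex (mu w) (fun t => Y w t * tilt w t).
  by rewrite -mulN1r -exZ; apply: eq_ex => t; rewrite /Y signed_part_flips mulN1r mulNr.
rewrite -[expR \o _]/(tilt w).
have /andP[m1 _] := tilt_mean k w.
by field; apply/eqP; lra.
Qed.

(** Apply [tilt_pointwise] to the increments in [gain_flip], with [e] the difference between [Y] and
    the true coordinate. The bounds 3/4 and 4/3 on the mean of [tilt] produce the constants. *)
Lemma gain_lower : lam / 4 * (3 / 4 * avg (fun w => ex2 (mu w) (fun s t => (coord w k s - coord w k t) ^+ 2))
   - 32 / 3 * avg (fun w => ex (mu w) (fun t => (y1 t - C k t) ^+ 2 + (y2 t - S k t) ^+ 2)))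
  <= avg (fun w => ex (mu w) (Y w)).
Proof.
rewrite gain_flip -mulNr -!avgZ -avgD -avgZ; apply: avg_le => w.
have mP := gibbs_prob (energy w) T0.
have /andP[m1 m2] := tilt_mean k w; set m := ex _ (tilt w) in m1 m2 *.
set P := ex2 _ _; set Q := ex _ _.
pose e t := Y w t - coord w k t.
have eQ : ex (mu w) (fun t => e t ^+ 2) <= Q.
  apply: (ex_le mP) => t _; rewrite /e signed_partB signed_part_sq.
  by case: (w k).2; rewrite ?lerDl ?lerDr sqr_ge0.
have := ex2_diff_sq mP e; set H := ex2 _ _ => HQ.
have P0 : 0 <= P by apply: (ex2_ge0 mP) => *; exact: sqr_ge0.
have H0 : 0 <= H by apply: (ex2_ge0 mP) => *; exact: sqr_ge0.
have : lam * P + - (4 * lam) * H <=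
    ex2 (mu w) (fun s t => (Y w s - Y w t) * (tilt w t - tilt w s)).
  rewrite -!ex2Z -ex2D; apply: (ex2_le mP) => s t.
  have [+ _] := tilt_pointwise (e s) (e t) lam0 lam8 (coord_le1 w k s) (coord_le1 w k t).
  rewrite /e !(addrC (coord _ _ _)) !subrK; apply: le_trans.
  by rewrite le_eqVlt; apply/orP; left; apply/eqP; rewrite /e; ring.
set V := ex2 _ _ => hV.
rewrite ler_pdivlMr; last by lra.
have h1 : lam * P * (3 / 4 * m) <= lam * P.
  by rewrite ler_piMr ?mulr_ge0 //; nra.
have h2 : 4 * lam * H <= lam / 4 * (32 / 3 * Q) * (4 * m).
  have HQ' : H <= 2 * Q by lra.
  have : lam * H <= lam * (2 * Q) by rewrite ler_wpM2l.
  have : 0 <= lam * Q by rewrite mulr_ge0 //; lra.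
  nra.
by apply: le_trans hV; nra.
Qed.

End Gain.

Lemma gain_upper k : k \in A -> avg (fun w => ex (mu w) (coord w k)) <=
  lam * avg (fun w => ex2 (mu w) (fun s t => (coord w k s - coord w k t) ^+ 2)).
Proof.
move=> kA; rewrite -avgZ (gain_flip (C k) (S k) kA); apply: avg_le => w.
have mP := gibbs_prob (energy w) T0.
have /andP[m1 m2] := tilt_mean k w; set m := ex _ _ in m1 m2 *.
set P := ex2 _ _; set V := ex2 _ _.
have P0 : 0 <= V by apply: (ex2_ge0 mP) => *; exact: sqr_ge0.
have : P <= 8 / 3 * lam * V.
  rewrite -ex2Z; apply: (ex2_le mP) => s t.
  by have [_] := tilt_pointwise 0 0 lam0 lam8 (coord_le1 w k s) (coord_le1 w k t).
rewrite ler_pdivrMr; last by lra.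
have : 0 <= lam * V by rewrite mulr_ge0.
nra.
Qed.

(** [dist2] is the squared increment of the part selected by [w] plus that of the other part.
    Switching the part moves the energy by at most 1/4, hence each density by a factor at most 2 and
    the double mean by at most 4; in total 1 + 4. *)
Lemma gain_mix k : k \in A -> avg (fun w => ex2 (mu w) (dist2 k)) <=
  5 * avg (fun w => ex2 (mu w) (fun s t => (coord w k s - coord w k t) ^+ 2)).
Proof.
move=> kA; set a := avg (fun w => ex2 _ (fun s t => _ ^+ 2)).
pose b := avg (fun w => ex2 (mu w) (fun s t => (coord (flipc k w) k s - coord (flipc k w) k t) ^+ 2)).
have -> : avg (fun w => ex2 (mu w) (dist2 k)) = a + b.
  rewrite -avgD; apply: eq_avg => w; rewrite -ex2D; congr ex2.
  by apply/funext => s; apply/funext => t; rewrite !signed_partB signed_part_flipc_sq.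
suff : b <= 4 * a by lra.
rewrite /b (avg_reindex _ (@flipc_inj k)) -avgZ; apply: avg_le => w /=.
have -> : flipc k (flipc k w) = w.
  by apply/ffunP => i; rewrite !ffunE; case: eqP => // _; rewrite negbK; case: (w i).
have -> : mu (flipc k w) = gibbs T (fun t => energy w t + lam * (coord (flipc k w) k t - coord w k t)).
  by congr gibbs; apply/funext => t; exact: energy_flipc.
have le2 t : gibbs T (fun t => energy w t + lam * (coord (flipc k w) k t - coord w k t)) t <= 2 * mu w t.
  apply: gibbs_tilt_le => // u; rewrite normrM (ger0_norm lam0).
  apply: (@le_trans _ _ (lam * 2)); last first.
  by have := lam8; lra.
  rewrite ler_wpM2l //; apply: le_trans (ler_normB _ _) _.
  by have := coord_le1 (flipc k w) k u; have := coord_le1 w k u; lra.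
have mP := gibbs_prob (energy w) T0.
rewrite /ex2 {1 3}/ex mulr_sumr; apply: ler_sum => s _.
have h : ex (gibbs T (fun t => energy w t + lam * (coord (flipc k w) k t - coord w k t)))
    (fun t => (coord w k s - coord w k t) ^+ 2) <= 2 * ex (mu w) (fun t => (coord w k s - coord w k t) ^+ 2).
  rewrite /ex mulr_sumr; apply: ler_sum => t _.
  by rewrite mulrA ler_wpM2r ?sqr_ge0.
have h0 := ex_ge0 mP (fun t => sqr_ge0 (coord w k s - coord w k t)).
have := le2 s; have := mP.1 s.
have := (gibbs_prob (fun t => energy w t + lam * (coord (flipc k w) k t - coord w k t)) T0).1 s.
move: h h0; set e1 := ex _ _; set e2 := ex _ _; set g1 := gibbs _ _ _; set g2 := mu w s.
move=> h h0 g10 g20 g12.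
apply: (@le_trans _ _ (g1 * (2 * e2))); first by rewrite ler_wpM2l.
have : g1 * (2 * e2) <= 2 * g2 * (2 * e2) by rewrite ler_wpM2r ?mulr_ge0.
by nra.
Qed.

Lemma avg_coord k t : avg (fun w => coord w k t) = 0.
Proof.
have : avg (fun w => coord w k t) = - avg (fun w => coord w k t).
  rewrite [LHS](avg_reindex _ (@flips_inj k)) -mulN1r -avgZ; apply: eq_avg => w /=.
  by rewrite /coord signed_part_flips mulN1r.
by lra.
Qed.

Section Spread.
Variables (r N : R).
Hypotheses (N3 : 3 <= N) (r0 : 0 < r) (lamr : lam ^+ 2 * r <= N / 4).
Hypothesis small_balls : forall t', #|T :&: [set t | \sum_(k in A) dist2 k t t' <= r]|%:R
  <= expR (- N) * #|T|%:R.

Let W := avg (fun w => ex2 (mu w) (fun s t => \sum_(k in A) dist2 k s t)).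

Lemma dist2_ge0 k s t : 0 <= dist2 k s t.
Proof. by rewrite addr_ge0 ?sqr_ge0. Qed.

Lemma spread_sum : W = \sum_(k in A) avg (fun w => ex2 (mu w) (dist2 k)).
Proof. by rewrite -avg_sum; apply: eq_avg => w; rewrite ex2_sum. Qed.

Lemma energy_upper : avg (fun w => ex (mu w) (energy w)) <= lam ^+ 2 * W.
Proof.
have -> : avg (fun w => ex (mu w) (energy w)) =
    lam * \sum_(k in A) avg (fun w => ex (mu w) (coord w k)).
  by rewrite -avg_sum -avgZ; apply: eq_avg => w; rewrite exZ ex_sum.
rewrite expr2 -mulrA ler_wpM2l // spread_sum mulr_sumr; apply: ler_sum => k kA.
apply: le_trans (gain_upper kA) _; rewrite ler_wpM2l //; apply: avg_le => w.
have mP := gibbs_prob (energy w) T0; apply: (ex2_le mP) => s t.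
by rewrite signed_partB signed_part_sq; case: (w k).2; rewrite ?lerDl ?lerDr sqr_ge0.
Qed.

(** [gibbs_concentration] is applied to the ball about a point [t'] which is itself drawn from the
    Gibbs measure. Markov's inequality bounds the mean mass of that ball from below through the
    spread. *)
Lemma energy_lower w : N * (1 - ex2 (mu w) (fun s t => \sum_(k in A) dist2 k s t) / r)
  + (\sum_(t in T) energy w t) / #|T|%:R - 1 <= ex (mu w) (energy w).
Proof.
have mP := gibbs_prob (energy w) T0.
have ln2 : ln 2 <= 1 :> R.
  rewrite -[leRHS]expRK ler_ln ?posrE ?expR_gt0 //.
  by have := expR_ge1Dx (1 : R); lra.
have := gibbs_jensen (energy w) T0; set L := ln _; set J := _ / _ => JL.
rewrite -[leRHS](ex_cst mP) /ex2 ex_exchange.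
have -> : N * (1 - ex (mu w) (fun t' => ex (mu w) (fun t => \sum_(k in A) dist2 k t t')) / r) + J - 1 =
  ex (mu w) (fun t' => N * (1 - ex (mu w) (fun t => \sum_(k in A) dist2 k t t') / r) + J - 1).
  rewrite exB exD exZ exB !ex_cst //; congr (N * (1 - _) + _ - _).
  by rewrite mulrC -exZ; apply: eq_ex => t; rewrite mulrC.
apply: (ex_le mP) => t' _.
apply: le_trans (gibbs_concentration (energy w) T0 (small_balls t')).
rewrite -/L; set a := ex _ _; set b := ex _ _.
suff : 1 - a / r <= b by have := N3; move: JL ln2; set l2 := ln 2; nra.
rewrite /a /b -[X in X - _](ex_cst mP) mulrC -exZ -exB; apply: (ex_le mP) => t _.
rewrite inE; have [h|h] /= := leP (\sum_(k in A) dist2 k t t') r.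
  by rewrite lerBlDr lerDl mulr_ge0 ?invr_ge0 ?(ltW r0) // sumr_ge0 // => k _; exact: dist2_ge0.
by rewrite subr_le0 ler_pdivlMl // mulr1 ltW.
Qed.

(** If the spread were below [r / 2], the mean energy would exceed [N / 2 - 1], the uniform mean of
    the energy being killed by the signs. But [energy_upper] would bound it by
    [lam ^+ 2 * r / 2 <= N / 8], which is impossible for [N >= 3]. *)
Lemma spread_lower : r / 2 <= W.
Proof.
have : avg (fun w => N * (1 - ex2 (mu w) (fun s t => \sum_(k in A) dist2 k s t) / r)
  + (\sum_(t in T) energy w t) / #|T|%:R - 1) <= lam ^+ 2 * W.
  by apply: le_trans energy_upper; apply: avg_le => w; exact: energy_lower.
have D0 : (0 < #|{: {ffun K -> bool * bool}}|)%N.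
  by apply/card_gt0P; exists [ffun=> (true, true)].
rewrite (_ : avg _ = N * (1 - W / r) - 1); last first.
  transitivity (avg (fun w => N + - (N / r) * ex2 (mu w) (fun s t => \sum_(k in A) dist2 k s t)
     + #|T|%:R^-1 * (lam * \sum_(t in T) \sum_(k in A) coord w k t) + - 1)).
    by apply: eq_avg => w; rewrite /energy -mulr_sumr; ring.
  have X0 : avg (fun w => \sum_(t in T) \sum_(k in A) coord w k t) = 0.
    rewrite avg_sum big1 // => t _; rewrite avg_sum big1 // => k _; exact: avg_coord.
  by rewrite !avgD !avgZ !avg_cst // X0 -/W; ring.
move=> H; rewrite leNgt; apply/negP => Wr.
have W0 : 0 <= W.
  apply: avg_ge0 => w; apply: (ex2_ge0 (gibbs_prob (energy w) T0)) => s t.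
  by apply: sumr_ge0 => k _; exact: dist2_ge0.
have h1 : lam ^+ 2 * W <= lam ^+ 2 * (r / 2) by rewrite ler_wpM2l ?sqr_ge0 ?ltW.
have h2 : W / r <= 2^-1 by rewrite ler_pdivrMr //; lra.
have := N3; have := lamr; nra.
Qed.

(** Sum [gain_lower] over the block. By [gain_mix] and [spread_lower] the squared increments total
    at least [r / 10], the error at most [r / 256], and (3/40 - 1/24) / 4 = 1/120. *)
Lemma stage_gain (y1 y2 : K -> G -> R) :
  (forall t, t \in T ->
    \sum_(k in A) ((y1 k t - C k t) ^+ 2 + (y2 k t - S k t) ^+ 2) <= r / 256) ->
  lam * r / 128 <= avg (fun w => ex (mu w)
     (fun t => \sum_(k in A) signed_part (w k) (y1 k t) (y2 k t))).
Proof.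
move=> yr.
have -> : avg (fun w => ex (mu w)
     (fun t => \sum_(k in A) signed_part (w k) (y1 k t) (y2 k t))) =
  \sum_(k in A) avg (fun w => ex (mu w) (fun t => signed_part (w k) (y1 k t) (y2 k t))).
  by rewrite -avg_sum; apply: eq_avg => w; rewrite ex_sum.
apply: le_trans (ler_sum _ (fun k kA => gain_lower (y1 k) (y2 k) kA)).
rewrite -mulr_sumr sumrB -[X in _ * (X - _)]mulr_sumr -[X in _ * (_ - X)]mulr_sumr.
have -> : \sum_(k in A) avg (fun w => ex (mu w) (fun t => (y1 k t - C k t) ^+ 2 + (y2 k t - S k t) ^+ 2))
  = avg (fun w => ex (mu w) (fun t => \sum_(k in A) ((y1 k t - C k t) ^+ 2 + (y2 k t - S k t) ^+ 2))).
  by rewrite -avg_sum; apply: eq_avg => w; rewrite ex_sum.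
set e := avg _; set v := \sum_(k in A) _.
have D0 : (0 < #|{: {ffun K -> bool * bool}}|)%N.
  by apply/card_gt0P; exists [ffun=> (true, true)].
have er : e <= r / 256.
  rewrite -(avg_cst (r / 256) D0); apply: avg_le => w.
  have mP := gibbs_prob (energy w) T0; rewrite -[leRHS](ex_cst mP).
  apply: (ex_le mP) => t; rewrite /gibbs; case: ifP => [tT _|]; last by rewrite eqxx.
  exact: yr.
have vW : W <= 5 * v.
  by rewrite spread_sum mulr_sumr; apply: ler_sum => k kA; exact: gain_mix.
have := spread_lower; have := lam0; have := r0; nra.
Qed.

End Spread.

End Stage.

(** * Chaining the stages *)

Section Mix.
Context {R : realType} (K : finType) (O : finType).

Definition mix (A : {set K}) (w w' : {ffun K -> O}) : {ffun K -> O} :=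
  [ffun k => if k \in A then w k else w' k].

(** The hypothesis says that [Phi] sees its first argument only on [A] and its second only off [A];
    two independent copies are then as good as one. *)
Lemma avg_mix (A : {set K}) (Phi : {ffun K -> O} -> {ffun K -> O} -> R) :
  (0 < #|{: {ffun K -> O}}|)%N ->
  (forall w w', Phi w w' = Phi (mix A w w') (mix A w w')) ->
  avg (fun w => avg (Phi w)) = avg (fun w => Phi w w).
Proof.
move=> c0 PhiE.
rewrite /avg -mulr_sumr mulrA pair_bigA /=.
under eq_bigr do rewrite PhiE.
(* Swapping the coordinates outside [A] is an involution of the pairs. *)
pose h (p : {ffun K -> O} * {ffun K -> O}) := (mix A p.1 p.2, mix A p.2 p.1).
have hI : injective h.
  apply: (can_inj (g := h)) => -[u v]; rewrite /h /=; congr pair.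
    by apply/ffunP => k; rewrite !ffunE; case: (k \in A).
  by apply/ffunP => k; rewrite !ffunE; case: (k \in A).
have -> : \sum_p Phi (mix A p.1 p.2) (mix A p.1 p.2) =
    \sum_(p : {ffun K -> O} * {ffun K -> O}) Phi p.1 p.1.
  by rewrite [RHS](reindex_inj hI).
rewrite -(pair_bigA _ (fun u _ => Phi u u)) /=.
under eq_bigr do rewrite sumr_const -mulr_natl.
rewrite -mulr_sumr mulrA; congr (_ * _).
by rewrite divfK // pnatr_eq0 -lt0n.
Qed.

End Mix.

Section Shift.
Context {R : realType} (G : finZmodType).

(** The mean over [x] of the size of [V] intersected with [x + B] is [|V| |B| / |G|]; some [x]
    reaches it. *)
Lemma shift_pigeonhole (V B : {set G}) :
  exists x, (#|V| * #|B| <= #|[set t in V | (t - x)%R \in B]| * #|G|)%N.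
Proof.
have E : (\sum_(x : G) #|[set t in V | (t - x)%R \in B]| = #|V| * #|B|)%N.
  under eq_bigr do rewrite -sum1dep_card.
  rewrite (exchange_big_dep (mem V)) /=; last by move=> x t _ /andP[].
  rewrite -sum_nat_const; apply: eq_bigr => t tV.
  rewrite (reindex_inj (inv_inj (subKr t))) /= sum1dep_card.
  by apply: eq_card => x; rewrite !inE tV subKr.
pose f x := #|[set t in V | (t - x)%R \in B]|.
pose x0 := [arg max_(x > (0%R : G)) f x]; exists x0.
rewrite -E mulnC -sum_nat_const; apply: leq_sum => x _.
by rewrite /x0; case: arg_maxnP => // i _; exact.
Qed.

Lemma shift_inter (Bs : seq {set G}) : exists V : {set G},
  (\prod_(B <- Bs) (#|B|%:R / #|G|%:R)) * #|G|%:R <= #|V|%:R :> R /\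
  forall B, B \in Bs -> exists x, forall t, t \in V -> t - x \in B.
Proof.
have G0 : 0 < #|G|%:R :> R by rewrite ltr0n; apply/card_gt0P; exists 0.
elim: Bs => [|B Bs [V [VG VB]]].
  by exists [set: G]; rewrite big_nil mul1r cardsT.
have [x hx] := shift_pigeonhole V B.
exists [set t in V | t - x \in B]; split.
  rewrite big_cons -mulrA.
  apply: (@le_trans _ _ (#|B|%:R / #|G|%:R * #|V|%:R)).
    by rewrite ler_wpM2l ?divr_ge0 ?ler0n.
  by rewrite mulrAC ler_pdivrMr // mulrC -!natrM ler_nat.
move=> B'; rewrite inE => /orP[/eqP->|/VB[y hy]].
  by exists x => t; rewrite inE => /andP[].
by exists y => t; rewrite inE => /andP[/hy].
Qed.

End Shift.

Section Maximum.
Context {R : realType} (G : finZmodType).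

(** The value at 0 serves as the initial element, so that no sign condition on [g] is imposed. *)
Definition maxG (g : G -> R) : R := \big[Num.max/g 0]_t g t.

Lemma le_maxG g t : g t <= maxG g.
Proof. exact: (le_bigmax_cond _ (fun t => g t)). Qed.

Lemma maxG_le g c : (forall t, g t <= c) -> maxG g <= c.
Proof. by move=> h; apply: bigmax_le => // t _; exact: h. Qed.

End Maximum.

(** * Composition of the Gibbs moves of separated blocks *)

Section Chain.
Context {R : realType} (G : finZmodType) (K : finType) (C S : K -> G -> R) (d : K -> G -> R).
Hypothesis C1 : forall k t, `|C k t| <= 1.
Hypothesis S1 : forall k t, `|S k t| <= 1.
Hypothesis dE : forall k s t, dist2 C S k s t = d k (s - t).

Definition dset (A : {set K}) t := \sum_(k in A) d k t.

Lemma dset0 A : dset A 0 = 0.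
Proof. by rewrite /dset big1 // => k _; rewrite -[0]subr0 -dE /dist2 !subrr expr0n addr0. Qed.

Lemma dsetN A t : dset A (- t) = dset A t.
Proof.
apply: eq_bigr => k _; rewrite -[X in _ = d k X]subr0 -[X in d k X = _]sub0r -!dE /dist2.
by congr (_ + _); rewrite -sqrrN opprB.
Qed.

(** Triangle inequality for a squared distance. The resulting factor 2 + 2 = 4 explains the powers
    of 4 in the radii below. *)
Lemma dsetD A u v : dset A (u + v) <= 2 * dset A u + 2 * dset A v.
Proof.
rewrite /dset !mulr_sumr -big_split; apply: ler_sum => k _ /=.
rewrite -[v]opprK -dE -[u in d k u]subr0 -(sub0r (- v)) -!dE /dist2.
move: (C k u) (C k 0) (C k (-v)) (S k u) (S k 0) (S k (-v)) => a b c a' b' c'.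
have := sqr_ge0 ((a - b) - (b - c)); have := sqr_ge0 ((a' - b') - (b' - c')); nra.
Qed.

Variables (A : nat -> {set K}) (b lam r N : nat -> R).

Definition signal (js : seq nat) w t := \sum_(j <- js) b j * \sum_(k in A j) coord C S w k t.

(** These are the hypotheses of [stage_gain] with [N j / 2] in place of [N j]: confining the moves
    may use up half of the entropy. *)
Definition admissible j := [/\ 0 <= b j, 0 <= lam j <= 8^-1, 0 < r j, 6 <= N j &
  lam j ^+ 2 * r j <= N j / 8].

(** Small balls have entropy at least [N j] at radius [r j], and the entropy grows by at most a
    factor [4 ^+ 6] each time the radius is divided by 4. *)
Definition entropic j :=
  #|[set t | dset (A j) t <= r j]|%:R <= expR (- N j) * #|G|%:R /\
  forall l, expR (- (4 ^+ (6 * (l + 6)) * N j)) * #|G|%:R <=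
     #|[set t | dset (A j) t <= r j / 4 ^+ (l + 6)]|%:R.

Definition good j := admissible j /\ entropic j.

(** [pre] lists the earlier blocks, the most recent first. The radius shrinks with the age [l] of
    the block, so that all subsequent moves together remain small for it. *)
Definition later_moves (pre : seq nat) : {set G} :=
  [set u | [forall l : 'I_(size pre), dset (A (nth 0%N pre l)) u <= r (nth 0%N pre l) / 4 ^+ (l + 5)]].

Lemma later_moves0 pre : (forall j, j \in pre -> good j) -> 0 \in later_moves pre.
Proof.
move=> pg; rewrite inE; apply/forallP => l; rewrite dset0.
have [[_ _ /ltW r0 _ _] _] := pg _ (mem_nth 0%N (ltn_ord l)).
by rewrite divr_ge0 ?exprn_ge0.
Qed.

(** [shift_inter] puts a large set inside translates of the balls of radius [r / 4 ^+ (l + 6)].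
    Differences with one fixed element [t0] return to balls centred at 0, at the cost of one factor
    4. *)
Lemma card_later_moves pre : (forall j, j \in pre -> good j) ->
  expR (- \sum_(l < size pre) 4 ^+ (6 * (l + 6)) * N (nth 0%N pre l)) * #|G|%:R <=
  #|later_moves pre|%:R.
Proof.
move=> pg.
pose B (l : 'I_(size pre)) := [set t | dset (A (nth 0%N pre l)) t <= r (nth 0%N pre l) / 4 ^+ (l + 6)].
have [V [VG VB]] := @shift_inter R G [seq B l | l <- enum 'I_(size pre)].
have G0 : 0 < #|G|%:R :> R by rewrite ltr0n; apply/card_gt0P; exists 0.
have {}VG : expR (- \sum_(l < size pre) 4 ^+ (6 * (l + 6)) * N (nth 0%N pre l)) * #|G|%:R <= #|V|%:R.
  apply: le_trans VG; rewrite ler_wpM2r ?ler0n // big_map -sumrN expR_sum.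
  rewrite big_enum /=.
  apply: ler_prod => l _; rewrite expR_ge0 /= ler_pdivlMr //.
  by have [_ []] := pg _ (mem_nth 0%N (ltn_ord l)).
apply: le_trans VG _; rewrite ler_nat.
have [->|[t0 t0V]] := finset.set_0Vmem V; first by rewrite cards0.
rewrite -(card_imset _ (@addIr _ (- t0))); apply/subset_leq_card/fintype.subsetP => u.
move=> /imsetP[t tV ->]; rewrite inE; apply/forallP => l.
have [|x hx] := VB (B l); first by apply: map_f; rewrite mem_enum.
have := hx _ tV; have := hx _ t0V; rewrite !inE => h1 h2.
have -> : t - t0 = (t - x) + - (t0 - x) by rewrite opprB addrA subrK.
apply: le_trans (dsetD _ _ _) _; rewrite dsetN.
have -> : r (nth 0%N pre l) / 4 ^+ (l + 5) = 4 * (r (nth 0%N pre l) / 4 ^+ (l + 6)).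
  by rewrite (_ : l + 6 = (l + 5).+1)%N ?exprS; [field|rewrite addnS].
by lra.
Qed.

Lemma sqr_ex_le (mu : G -> R) f c : is_prob mu ->
  (ex mu f - c) ^+ 2 <= ex mu (fun t => (f t - c) ^+ 2).
Proof.
move=> mP; set m := ex mu f.
have -> : ex mu (fun t => (f t - c) ^+ 2) =
    (m - c) ^+ 2 + ex mu (fun t => (f t - m) ^+ 2).
  transitivity (ex mu (fun t => (m - c) ^+ 2 + (f t - m) ^+ 2 + 2 * (m - c) * f t + - (2 * (m - c) * m))).
    by apply: eq_ex => t; ring.
  by rewrite !exD exZ !ex_cst // -/m; ring.
by rewrite lerDl; apply: (ex_ge0 mP) => t; exact: sqr_ge0.
Qed.

Lemma ex_signed_part (mu : G -> R) w (f g : G -> R) :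
  ex mu (fun t => signed_part w (f t) (g t)) = signed_part w (ex mu f) (ex mu g).
Proof. by rewrite /signed_part exZ; case: w.2. Qed.

Lemma signal_cons a js w t :
  signal (a :: js) w t = b a * \sum_(k in A a) coord C S w k t + signal js w t.
Proof. by rewrite /signal big_cons. Qed.

Section Step.
Variables (a : nat) (pre rest : seq nat) (kb : G -> G -> R).
Hypothesis kbP : forall s, is_prob (kb s).
Hypothesis kb_near : forall s t, kb s t != 0 -> dset (A a) (t - s) <= r a / 4 ^+ 4.
Hypothesis ag : good a.
Variable U : {set G}.
Hypothesis U0 : 0 \in U.
Hypothesis UG : expR (- (N a / 2)) * #|G|%:R <= #|U|%:R.

Let T s := [set t | t - s \in U].
Let mu s w := gibbs (T s) (energy C S (A a) (lam a) w).

(** The current Gibbs move followed by the kernel [kb] of the later stages; averaging over [w] makes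
    the composite kernel independent of the signs. *)
Definition next_kernel s t := avg (fun w => ex (mu s w) (fun t1 => kb t1 t)).

Let T0 s : T s != finset.set0.
Proof. by apply/finset.set0Pn; exists s; rewrite inE subrr. Qed.

Let muP s w : is_prob (mu s w).
Proof. exact: gibbs_prob. Qed.

Let O0 : (0 < #|{: {ffun K -> bool * bool}}|)%N.
Proof. by apply/card_gt0P; exists [ffun=> (true, true)]. Qed.

Lemma next_kernel_prob s : is_prob (next_kernel s).
Proof.
split=> [t|]; first by apply: avg_ge0 => w; apply: (ex_ge0 (muP s w)) => t1; have [] := kbP t1.
rewrite -avg_sum -[RHS](avg_cst 1 O0); apply: eq_avg => w.
rewrite -ex_sum -[RHS](ex_cst (muP s w)); apply: eq_ex => t1.
by have [] := kbP t1.
Qed.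

Lemma next_kernel_supp s t : next_kernel s t != 0 ->
  exists2 t1, t1 - s \in U & kb t1 t != 0.
Proof.
move=> h; apply/exists_inP; apply: contraNT h => /exists_inPn h.
rewrite -[X in _ == X](avg_cst 0 O0); apply/eqP; apply: eq_avg => w.
rewrite /ex big1 // => t1 _; rewrite /mu /gibbs inE.
case: ifP => [tU|_]; last by rewrite mul0r.
by have := h _ tU; rewrite negbK => /eqP->; rewrite mulr0.
Qed.

Lemma next_kernel_ex s h :
  avg (fun w => ex (mu s w) (fun t1 => ex (kb t1) h)) = ex (next_kernel s) h.
Proof.
rewrite /ex /next_kernel.
under eq_avg do under eq_bigr do rewrite mulr_sumr.
under eq_avg do rewrite exchange_big.
rewrite avg_sum; apply: eq_bigr => t _ /=.
rewrite mulrC -avgZ; apply: eq_avg => w; rewrite mulr_sumr.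
by apply: eq_bigr => t1 _; ring.
Qed.

Lemma cardT s : #|T s| = #|U|.
Proof.
rewrite -(card_imset (T s) (@addIr _ (- s))); congr #|pred_of_set _|; apply/setP => u.
apply/imsetP/idP => [[t + ->]|uU]; first by rewrite inE.
by exists (u + s); rewrite ?inE addrK.
Qed.

(** [stage_gain] on the translate [T s] of [U], with [y1] and [y2] the means under [kb]. A ball has
    at most [expR (- N a) * |G|] points and [U] at least [expR (- (N a / 2)) * |G|], so entropy
    [N a / 2] is left; Jensen's inequality and [kb_near] bound the error by [r a / 4 ^+ 4], that is
    [r a / 256]. *)
Lemma next_kernel_gain s : b a * lam a * r a / 128 <=
  avg (fun w => ex (mu s w) (fun t1 => ex (kb t1) (fun t => b a * \sum_(k in A a) coord C S w k t))).
Proof.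
have [[b0 /andP[l0 l8] r0 N6 lr] [hball _]] := ag.
have -> : avg (fun w => ex (mu s w) (fun t1 => ex (kb t1) (fun t => b a * \sum_(k in A a) coord C S w k t))) =
  b a * avg (fun w => ex (mu s w) (fun t1 =>
     \sum_(k in A a) signed_part (w k) (ex (kb t1) (C k)) (ex (kb t1) (S k)))).
  rewrite -avgZ; apply: eq_avg => w; rewrite -exZ; apply: eq_ex => t1.
  by rewrite exZ ex_sum; congr (_ * _); apply: eq_bigr => k _; rewrite -ex_signed_part.
rewrite -!mulrA ler_wpM2l // mulrA.
apply: (@stage_gain _ _ _ C S C1 S1 _ (T s) (T0 s) (lam a) l0 l8 _ (N a / 2)) => //.
- by lra.
- by lra.
- move=> t'; rewrite cardT.
  apply: (@le_trans _ _ #|[set t | dset (A a) t <= r a]|%:R).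
    rewrite ler_nat -(card_imset _ (@addIr _ (- t'))); apply/subset_leq_card/fintype.subsetP => u.
    move=> /imsetP[t + ->]; rewrite !inE => /andP[_].
    by rewrite /dset; under eq_bigr do rewrite dE.
  apply: le_trans hball _.
  have -> : - N a = - (N a / 2) + - (N a / 2) by lra.
  by rewrite expRD -mulrA ler_wpM2l ?expR_ge0.
- move=> t _.
  apply: (@le_trans _ _ (ex (kb t) (fun u => dset (A a) (u - t)))).
    rewrite ex_sum; apply: ler_sum => k _; rewrite -(eq_ex _ (fun u => dE k u t)) exD.
    by rewrite lerD // sqr_ex_le.
  rewrite -[leRHS](ex_cst (kbP t)); apply: (ex_le (kbP t)) => u ku.
  apply: le_trans (kb_near ku) _.
  by rewrite ler_wpM2l ?(ltW r0) //; lra.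
Qed.

Hypothesis disj : forall j, j \in rest -> [disjoint A a & A j].
Variable c : R.
Hypothesis kb_value : forall s h,
  c + ex (kb s) h <= avg (fun w => maxG (fun t => signal rest w t + h t)).

(** The block [A a] is disjoint from the later ones, so its signs may be decoupled by [avg_mix]. For
    fixed [w], its contribution [f w] joins the test function [h] in [kb_value], started at a point
    [t1] drawn from the Gibbs measure of [w]. *)
Lemma next_kernel_value s h :
  b a * lam a * r a / 128 + c + ex (next_kernel s) h <=
  avg (fun w => maxG (fun t => signal (a :: rest) w t + h t)).
Proof.
pose f w t := b a * \sum_(k in A a) coord C S w k t.
rewrite [leRHS](_ : _ = avg (fun w => avg (fun w' =>
    maxG (fun t => signal rest w' t + (f w t + h t))))); last first.
  rewrite (@avg_mix _ _ _ (A a)) //.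
    apply: eq_avg => w; congr maxG; apply/funext => t.
    by rewrite signal_cons addrCA addrA.
  move=> w w'; congr maxG; apply/funext => t; congr (_ + (_ + _)).
    rewrite /signal; apply: eq_big_seq => j jr; congr (_ * _).
    apply: eq_bigr => k kA; rewrite /coord ffunE; case: ifP => // kAa.
    by have /disjoint_setI0 := disj jr; move/setP/(_ k); rewrite !inE kAa kA.
  by rewrite /f; congr (_ * _); apply: eq_bigr => k kA; rewrite /coord ffunE kA.
apply: (@le_trans _ _ (avg (fun w => c + ex (mu s w) (fun t1 => ex (kb t1) (f w))
     + ex (mu s w) (fun t1 => ex (kb t1) h)))).
  by rewrite !avgD avg_cst // next_kernel_ex lerD2r addrC lerD2l next_kernel_gain.
apply: avg_le => w; rewrite -addrA -exD -[X in X + _](ex_cst (muP s w)) -exD.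
rewrite -[leRHS](ex_cst (muP s w)); apply: (ex_le (muP s w)) => t1 _.
by rewrite -exD.
Qed.

End Step.

Lemma separated_decay a pre :
  sorted (fun i j => 4 ^+ 37 * N i <= N j) (rev pre ++ [:: a]) ->
  forall l, (l < size pre)%N -> (4 ^+ 37) ^+ l.+1 * N (nth 0%N pre l) <= N a.
Proof.
elim: pre a => // p pre IH a; rewrite rev_cons cat_rcons => srt.
have pa : 4 ^+ 37 * N p <= N a by have /andP[] := (cat_sorted2 srt).2.
have srt' : sorted (fun i j => 4 ^+ 37 * N i <= N j) (rev pre ++ [:: p]).
  by move: srt; rewrite -cat_rcons -cats1 => srt; exact: (cat_sorted2 srt).1.
case=> [_|l ls]; first by rewrite expr1.
apply: le_trans pa; rewrite exprS -mulrA ler_wpM2l ?exprn_ge0 //.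
exact: IH.
Qed.

Lemma half_geometric n : \sum_(l < n) 4^-1 * 2^-1 ^+ l = 2^-1 * (1 - 2^-1 ^+ n) :> R.
Proof.
elim: n => [|n IH]; first by rewrite big_ord0 expr0 subrr mulr0.
by rewrite big_ord_recr /= IH exprS; field.
Qed.

(** The block of age [l] has entropy at most [4 ^- (37 (l + 1)) * N a]. Since 37 = 36 + 1,
    multiplying by [4 ^+ (6 * (l + 6))] leaves at most [N a * 4^-1 * 2 ^- l], and these sum to less
    than [N a / 2]. *)
Lemma entropy_budget a pre : 0 <= N a -> (forall j, j \in pre -> good j) ->
  sorted (fun i j => 4 ^+ 37 * N i <= N j) (rev pre ++ [:: a]) ->
  \sum_(l < size pre) 4 ^+ (6 * (l + 6)) * N (nth 0%N pre l) <= N a / 2.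
Proof.
move=> Na pg srt.
apply: (@le_trans _ _ (\sum_(l < size pre) N a * (4^-1 * 2^-1 ^+ l))); last first.
  rewrite -mulr_sumr half_geometric ler_wpM2l //.
  have : 0 <= 2^-1 ^+ size pre :> R by rewrite exprn_ge0.
  by lra.
apply: ler_sum => l _; have := separated_decay srt (ltn_ord l).
have [[_ _ _ N6 _] _] := pg _ (mem_nth 0%N (ltn_ord l)).
move: (N (nth _ _ _)) N6 => n n6 h.
rewrite exprVn -invfM ler_pdivlMr ?mulr_gt0 ?exprn_gt0 //; apply: le_trans h.
rewrite mulrAC ler_wpM2r //; first by lra.
have -> : 4 = 2 ^+ 2 :> R by rewrite expr2; lra.
by rewrite -!exprM -!exprD ler_weXn2l //; [lra|lia].
Qed.

(** Induction on the stages still to come, with those in [pre] already performed. The second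
    property protects the gains of [pre]; the arbitrary [h] in the third lets earlier blocks be
    added to the signal. *)
Lemma chain_value pre rest : (forall j, j \in pre ++ rest -> good j) ->
  sorted (fun i j => 4 ^+ 37 * N i <= N j) (rev pre ++ rest) ->
  (forall i j, i != j -> [disjoint A i & A j]) -> uniq rest ->
  exists kb : G -> G -> R, [/\ forall s, is_prob (kb s),
   forall s t, kb s t != 0 -> forall l, (l < size pre)%N ->
     dset (A (nth 0%N pre l)) (t - s) <= r (nth 0%N pre l) / 4 ^+ (l + 4) &
   forall s h, \sum_(j <- rest) (b j * lam j * r j / 128) + ex (kb s) h <=
      avg (fun w => maxG (fun t => signal rest w t + h t))].
Proof.
elim: rest pre => [|a rest IH] pre.
  (* No stage is left: the point stays where it is. *)
  rewrite cats0 => pg _ _ _; exists (fun s t => (t == s)%:R); split.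
  - move=> s; split=> [t|]; first by case: eqP.
    by rewrite (bigD1 s) //= eqxx big1 ?addr0 // => t /negbTE->.
  - move=> s t; rewrite pnatr_eq0 eqb0 negbK => /eqP-> l ls; rewrite subrr dset0.
    have [[_ _ /ltW r0 _ _] _] := pg _ (mem_nth 0%N ls).
    by rewrite divr_ge0 ?exprn_ge0.
  - move=> s h; rewrite big_nil add0r.
    have O0 : (0 < #|{: {ffun K -> bool * bool}}|)%N.
      by apply/card_gt0P; exists [ffun=> (true, true)].
    rewrite -[leLHS](avg_cst _ O0); apply: avg_le => w.
    rewrite /ex (bigD1 s) //= eqxx mul1r big1 ?addr0; last first.
      by move=> t /negbTE->; rewrite mul0r.
    by apply: le_trans (le_maxG _ s); rewrite /signal big_nil add0r.
move=> pg srt disj /andP[aN uq].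
have [||kb [kbP kb_supp kbV]] := IH (a :: pre) _ _ disj uq.
- by move=> j; rewrite /= inE => /orP[/eqP->|]; [|rewrite mem_cat => /orP[] jp]; apply: pg;
    rewrite mem_cat inE ?eqxx ?jp ?orbT.
- by rewrite rev_cons cat_rcons.
have preg j : j \in pre -> good j by move=> jp; apply: pg; rewrite mem_cat jp.
have ag : good a by apply: pg; rewrite mem_cat inE eqxx orbT.
have kb4 s t : kb s t != 0 -> dset (A a) (t - s) <= r a / 4 ^+ 4.
  by move=> /kb_supp/(_ 0%N isT).
have UG : expR (- (N a / 2)) * #|G|%:R <= #|later_moves pre|%:R.
  apply: le_trans (card_later_moves preg); rewrite ler_wpM2r ?ler0n // ler_expR lerN2.
  apply: entropy_budget preg _; first by have [[_ _ _ N6 _] _] := ag; lra.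
  by move: srt; rewrite -cat_rcons -cats1 => srt; exact: (cat_sorted2 srt).1.
exists (next_kernel a kb (later_moves pre)); split.
- exact: next_kernel_prob (later_moves0 preg).
- move=> s t /next_kernel_supp[t1 t1U kt] l ls.
  move: t1U; rewrite inE => /forallP /(_ (Ordinal ls)) /= h1.
  have /= h2 := kb_supp _ _ kt l.+1 ls.
  (* The current move and the later ones are both within [r / 4 ^+ (l + 5)]; [dsetD] loses exactly
     the factor 4. *)
  have -> : t - s = (t - t1) + (t1 - s) by rewrite addrA subrK.
  apply: le_trans (dsetD _ _ _) _.
  move: h1 h2.
  have -> : 4 ^+ (l + 5) = 4 * 4 ^+ (l + 4) :> R by rewrite -exprS addnS.
  have -> : 4 ^+ (l.+1 + 4) = 4 * 4 ^+ (l + 4) :> R by rewrite -exprS.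
  by rewrite invfM; lra.
- move=> s h; rewrite big_cons; apply: next_kernel_value => //.
  + exact: later_moves0.
  + move=> j jr; apply: disj; apply: contraNneq aN => ->; exact: jr.
Qed.

End Chain.

(** * Choice of the scale *)

Section Scale.
Context {R : realType} (G : finZmodType) (K : finType) (C S : K -> G -> R) (d : K -> G -> R).
Hypothesis C1 : forall k t, `|C k t| <= 1.
Hypothesis S1 : forall k t, `|S k t| <= 1.
Hypothesis dE : forall k s t, dist2 C S k s t = d k (s - t).

(** Index of [c] in the division of [-1, 1] into [P.+1] equal cells; the minimum puts the endpoint 1
    into the last cell. *)
Definition cell (P : nat) (c : R) : 'I_P.+1 := inord (minn P (Num.truncn ((c + 1) / 2 * P.+1%:R))).

Lemma cell_bounds P c : `|c| <= 1 ->
  (cell P c)%:R <= (c + 1) / 2 * P.+1%:R <= (cell P c)%:R + 1.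
Proof.
rewrite ler_norml => /andP[c0 c1]; rewrite /cell inordK ?ltnS ?geq_minl //.
set y := _ * _.
have y0 : 0 <= y by rewrite mulr_ge0 //; lra.
have yP : y <= P%:R + 1.
  by rewrite /y natr1 ler_piMl //; lra.
have /andP[t1 t2] := truncn_itv y0.
rewrite /minn; case: ltnP => h; rewrite ?yP ?andbT.
  by apply: le_trans t1; rewrite ler_nat ltnW.
by rewrite t1 /= natr1 ltW.
Qed.

Lemma cell_close P c c' : `|c| <= 1 -> `|c'| <= 1 -> cell P c = cell P c' ->
  (c - c') ^+ 2 <= 4 / P.+1%:R ^+ 2.
Proof.
move=> h h' e; have /andP[a1 a2] := cell_bounds P h; have /andP[b1 b2] := cell_bounds P h'.
rewrite e in a1 a2; move: (_%:R) (P.+1%:R) (ltr0Sn R P) a1 a2 b1 b2 => i p p0 a1 a2 b1 b2.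
rewrite ler_pdivlMr ?exprn_gt0 // -exprMn.
have : -2 <= (c - c') * p <= 2 by apply/andP; split; lra.
by move=> /andP[]; nra.
Qed.

(** Pigeonhole, one frequency at a time: keep the most populated of the [P.+1 ^ 2] cells for the
    pair [(C k, S k)]. *)
Lemma common_cell P (As : seq K) : exists V : {set G},
  (#|G| <= (P.+1 ^ 2) ^ size As * #|V|)%N /\
  forall k, k \in As -> forall t t', t \in V -> t' \in V -> d k (t - t') <= 8 / P.+1%:R ^+ 2.
Proof.
elim: As => [|k As [V [VG hV]]].
  by exists [set: G]; rewrite mul1n cardsT.
pose f (ij : 'I_P.+1 * 'I_P.+1) := #|[set t in V | (cell P (C k t), cell P (S k t)) == ij]|.
pose m := [arg max_(ij > (ord0, ord0)) f ij].
exists [set t in V | (cell P (C k t), cell P (S k t)) == m]; split.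
  apply: leq_trans VG _; rewrite /= (expnS (P.+1 ^ 2)) [X in (_ <= X * _)%N]mulnC -mulnA leq_mul2l.
  apply/orP; right.
  have -> : #|V| = (\sum_ij f ij)%N.
    rewrite /f; under eq_bigr do rewrite -sum1dep_card.
    rewrite (exchange_big_dep (mem V)) /=; last by move=> ij t _ /andP[].
    rewrite -sum1_card; apply: eq_bigr => t tV.
    by rewrite (eq_bigl (pred1 (cell P (C k t), cell P (S k t)))) ?big_pred1_eq // => ij; rewrite /= tV eq_sym.
  apply: (@leq_trans (\sum_(ij : 'I_P.+1 * 'I_P.+1) f m)%N).
    by apply: leq_sum => ij _; rewrite /m; case: arg_maxnP => // i _; exact.
  by rewrite sum_nat_const card_prod !card_ord mulnn.
move=> j; rewrite inE => /orP[/eqP->|jA] t t'; rewrite !inE => /andP[tV e] /andP[t'V e'].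
  rewrite -dE /dist2; move: e' e => /eqP<- /eqP[e1 e2].
  have := cell_close (C1 k t) (C1 k t') e1; have := cell_close (S1 k t) (S1 k t') e2.
  by rewrite (_ : 8 / _ = 4 / P.+1%:R ^+ 2 + 4 / P.+1%:R ^+ 2) => [h1 h2|]; [rewrite lerD|rewrite -mulrDl; congr (_ / _); lra].
exact: hV.
Qed.

Variable A : {set K}.
Hypothesis A0 : (0 < #|A|)%N.
Local Notation n := (#|A|%:R : R).

Let Gn : (0 < #|G|)%N.
Proof. by apply/card_gt0P; exists 0. Qed.

Definition ball_card l := #|[set t | dset d A t <= n / 4 ^+ l]|.
Definition scale_entropy l : R := - ln ((ball_card l)%:R / #|G|%:R).

Let G0 : 0 < #|G|%:R :> R.
Proof. by rewrite ltr0n; apply/card_gt0P; exists 0. Qed.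

Lemma ball_card_gt0 l : (0 < ball_card l)%N.
Proof.
apply/card_gt0P; exists 0; rewrite inE (dset0 dE).
by rewrite divr_ge0 ?exprn_ge0.
Qed.

Lemma scale_entropyK l : expR (- scale_entropy l) * #|G|%:R = (ball_card l)%:R.
Proof.
rewrite /scale_entropy opprK lnK ?posrE ?divr_gt0 ?ltr0n ?Gn ?ball_card_gt0 //.
by rewrite divfK ?gt_eqF.
Qed.

Lemma scale_entropyE l : scale_entropy l = ln (#|G|%:R / (ball_card l)%:R).
Proof. by rewrite /scale_entropy -lnV ?invf_div // posrE divr_gt0 ?ltr0n ?Gn ?ball_card_gt0. Qed.

Lemma scale_entropy_leG l : scale_entropy l <= ln #|G|%:R.
Proof.
rewrite scale_entropyE ler_ln ?posrE ?divr_gt0 ?ltr0n ?Gn ?ball_card_gt0 //.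
by rewrite ler_pdivrMr ?ltr0n ?ball_card_gt0 // ler_peMr ?ler1n ?ball_card_gt0 // ltW.
Qed.

(** Cells with [P.+1 = 3 * 2 ^ l] give squared distance at most 8 / (9 * 4^l) per frequency, so a
    translate of a common cell lies in the ball. The entropy is at most [n * ln (9 * 4 ^+ l)], and
    dropping the logarithm is affordable. *)
Lemma scale_entropy_le l : scale_entropy l <= 9 * n * 4 ^+ l.
Proof.
have [V [VG hV]] := common_cell (3 * 2 ^ l).-1 (enum A).
have P1 : ((3 * 2 ^ l).-1.+1 = 3 * 2 ^ l)%N by rewrite prednK // muln_gt0 expn_gt0.
rewrite P1 -cardE in VG hV.
have P2 : ((3 * 2 ^ l)%:R : R) ^+ 2 = 9 * 4 ^+ l.
  rewrite natrM natrX exprMn exprAC; congr (_ * _ ^+ _).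
    by rewrite expr2; lra.
  by rewrite expr2; lra.
have VB : (#|V| <= ball_card l)%N.
  have [->|[t0 t0V]] := finset.set_0Vmem V; first by rewrite cards0.
  rewrite -(card_imset V (@addIr _ (- t0))); apply/subset_leq_card/fintype.subsetP => u.
  move=> /imsetP[t tV ->]; rewrite inE.
  apply: (@le_trans _ _ (\sum_(k in A) 8 / (9 * 4 ^+ l))).
    by apply: ler_sum => k kA; rewrite -P2; apply: hV; rewrite ?mem_enum.
  rewrite sumr_const -[_ *+ #|A|]mulr_natl.
  apply: ler_wpM2l => //.
  rewrite invfM mulrA ler_piMl ?invr_ge0 ?exprn_ge0 //; lra.
have H : expR (scale_entropy l) <= (9 * 4 ^+ l) ^+ #|A|.
  rewrite scale_entropyE lnK ?posrE ?divr_gt0 ?ltr0n ?Gn ?ball_card_gt0 //.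
  rewrite ler_pdivrMr ?ltr0n ?ball_card_gt0 // -P2 -!natrX -natrM ler_nat.
  by apply: leq_trans VG _; rewrite leq_mul2l VB orbT.
rewrite -ler_expR; apply: le_trans H _.
rewrite (mulrC 9 n) -mulrA (@expRM_natl _ #|A|) lerXn2r // ?nnegrE ?expR_ge0 ?mulr_ge0 ?exprn_ge0 //.
by apply: le_trans (expR_ge1Dx _); rewrite lerDr.
Qed.

Lemma ball_card_mono l m : (l <= m)%N -> (ball_card m <= ball_card l)%N.
Proof.
move=> lm; apply/subset_leq_card/fintype.subsetP => t; rewrite !inE => /le_trans; apply.
by rewrite ler_wpM2l // lef_pV2 ?posrE ?exprn_gt0 // ler_weXn2l // ler1n.
Qed.

Lemma scale_entropy_mono l m : (l <= m)%N -> scale_entropy l <= scale_entropy m.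
Proof.
move=> lm; rewrite -lerN2 -ler_expR -(ler_pM2r G0) !scale_entropyK ler_nat.
exact: ball_card_mono.
Qed.

(* A scale at which the entropy, discounted by the factor [4 ^- 6] per scale, is maximal. *)
Lemma best_scale : 0 < scale_entropy 0 -> exists l,
  4 ^+ (6 * l) * scale_entropy 0 <= scale_entropy l /\
  forall m, scale_entropy (l + m) <= 4 ^+ (6 * m) * scale_entropy l.
Proof.
move=> e0; have e0' : 0 <= scale_entropy 0 by rewrite ltW.
pose v l := scale_entropy l / 4 ^+ (6 * l).
(* The entropy never exceeds [ln |G|], so beyond [M] the discounted value is at most that of scale 0
   and a finite maximum suffices. *)
pose M := Num.truncn (ln #|G|%:R / scale_entropy 0).
pose l := [arg max_(l > (ord0 : 'I_M.+1)) v l]%O.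
have far k : (M < k)%N -> v k <= v 0%N.
  move=> Mk; rewrite /v muln0 expr0 divr1 ler_pdivrMr ?exprn_gt0 //.
  apply: le_trans (scale_entropy_leG k) _; rewrite mulrC -ler_pdivrMr //.
  apply: (@le_trans _ _ k%:R).
    have /andP[_ /ltW h] : M%:R <= ln #|G|%:R / scale_entropy 0 < M.+1%:R.
      apply: truncn_itv; rewrite divr_ge0 ?ln_ge0 // ler1n.
      by apply/card_gt0P; exists 0.
    by apply: le_trans h _; rewrite ler_nat.
  rewrite -natrX ler_nat; apply: ltnW; apply: leq_trans (ltn_expl k (isT : (1 < 4)%N)) _.
  by rewrite leq_pexp2l // leq_pmull.
have lmax k : v k <= v l.
  have h0 : forall i : 'I_M.+1, v i <= v l by rewrite /l; case: arg_maxP => // i _ h j; exact: h.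
  case: (ltnP M k) => [/far Mk|kM]; first exact: le_trans (h0 ord0).
  exact: (h0 (Ordinal (kM : (k < M.+1)%N))).
exists l; split.
  by have := lmax 0%N; rewrite /v muln0 expr0 divr1 ler_pdivlMr ?exprn_gt0 // mulrC.
move=> m; have := lmax (l + m)%N; rewrite /v ler_pdivrMr ?exprn_gt0 //.
rewrite mulnDr exprD mulrA divfK ?gt_eqF ?exprn_gt0 //.
by rewrite mulrC.
Qed.

(** Take [r] and [N] from the best scale, and for [lam] the largest value that the two constraints
    allow. The fourth-power inequality says that the gain [lam * r] is at least sqrt(n g) (N /
    g)^(1/4) / 24; the surplus over sqrt(n g) pays for the blocks lost to separation. *)
Lemma scale_choice g : 6 <= g ->
  #|[set t | dset d A t <= n]|%:R <= expR (- g) * #|G|%:R ->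
  exists lam r N : R, [/\ 0 <= lam <= 8^-1, 0 < r, g <= N, lam ^+ 2 * r <= N / 8 &
   [/\ n ^+ 2 * g * N <= (24 * (lam * r)) ^+ 4,
    #|[set t | dset d A t <= r]|%:R <= expR (- N) * #|G|%:R &
    forall l, expR (- (4 ^+ (6 * (l + 6)) * N)) * #|G|%:R <=
     #|[set t | dset d A t <= r / 4 ^+ (l + 6)]|%:R]].
Proof.
move=> g6 hg.
have e0 : g <= scale_entropy 0.
  rewrite -lerN2 -ler_expR -(ler_pM2r G0) scale_entropyK /ball_card expr0 divr1.
  exact: hg.
have [|l [hl lm]] := best_scale; first by lra.
set N := scale_entropy l in hl lm; pose r : R := n / 4 ^+ l.
have n0 : 0 < n by rewrite ltr0n.
have x0 : 0 < 4 ^+ l :> R by rewrite exprn_gt0.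
have r0 : 0 < r by rewrite divr_gt0.
have gN : 4 ^+ (6 * l) * g <= N by apply: le_trans hl; rewrite ler_wpM2l ?exprn_ge0.
have gN' : g <= N by apply: le_trans e0 _; exact: scale_entropy_mono.
have N0 : 0 < N by lra.
have Nx : N <= 9 * n * 4 ^+ l := scale_entropy_le l.
pose s := Num.sqrt (N / (8 * r)).
have s2 : s ^+ 2 = N / (8 * r) by rewrite sqr_sqrtr // divr_ge0 ?mulr_ge0 // ltW.
have s0 : 0 <= s := sqrtr_ge0 _.
exists (Num.min 8^-1 s), r, N; split => //.
- by rewrite ge_min lexx le_min s0 andbT /=; lra.
- apply: (@le_trans _ _ (s ^+ 2 * r)).
    by rewrite ler_wpM2r ?(ltW r0) // ler_sqr ?nnegrE ?le_min ?s0 ?andbT ?ge_min ?lexx ?orbT //; lra.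
  by rewrite s2 le_eqVlt; apply/orP; left; apply/eqP; field; rewrite gt_eqF.
split.
- have rx : r * 4 ^+ l = n by rewrite divfK // gt_eqF.
  move: gN; rewrite mulnC exprM.
  have x1 : 1 <= 4 ^+ l :> R by rewrite exprn_ege1 // ler1n.
  move: (4 ^+ l) x0 x1 rx Nx => x x0 x1 rx Nx gN.
  have g0 : 0 <= g by lra.
  rewrite /Num.min; case: ltP => _.
    (* With [lam = 1/8], combine [g * x ^+ 6 <= N] with the crude bound [N <= 9 * n * x]. *)
    have -> : (24 * (8^-1 * r)) ^+ 4 = 81 * r ^+ 4 by field.
    have h1 : g * N * x ^+ 4 <= 81 * n ^+ 2.
      have h2 : g * N * x ^+ 6 <= (9 * n * x) ^+ 2.
        apply: (@le_trans _ _ (N * N)); last first.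
          by rewrite -expr2 ler_sqr // nnegrE ?(ltW N0) // !mulr_ge0 // ltW.
        by rewrite mulrAC [g * _]mulrC ler_wpM2r // ltW.
      rewrite -(ler_pM2r (exprn_gt0 2 x0)).
      have -> : g * N * x ^+ 4 * x ^+ 2 = g * N * x ^+ 6 by ring.
      apply: le_trans h2 _.
      by rewrite le_eqVlt; apply/orP; left; apply/eqP; ring.
    rewrite -(ler_pM2r (exprn_gt0 4 x0)) -[X in _ <= X]mulrA -exprMn rx.
    have -> : n ^+ 2 * g * N * x ^+ 4 = n ^+ 2 * (g * N * x ^+ 4) by ring.
    have -> : 81 * n ^+ 4 = n ^+ 2 * (81 * n ^+ 2) by ring.
    by rewrite ler_wpM2l ?sqr_ge0.
  (* With [lam = s], the fourth power is a multiple of [(r * N) ^+ 2], and [g * x ^+ 2 <= N]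
     suffices. *)
  have -> : (24 * (s * r)) ^+ 4 = 24 ^+ 4 * (s ^+ 2) ^+ 2 * r ^+ 4 by ring.
  rewrite s2.
  have -> : 24 ^+ 4 * (N / (8 * r)) ^+ 2 * r ^+ 4 = 5184 * N * (r ^+ 2 * N).
    by field; rewrite gt_eqF.
  have h : n ^+ 2 * g <= r ^+ 2 * N.
    rewrite -rx exprMn -mulrA ler_wpM2l ?sqr_ge0 //.
    apply: le_trans gN; rewrite ler_wpM2r //.
    by rewrite ler_weXn2l.
  rewrite [5184 * _ * _]mulrC.
  have : 0 <= r ^+ 2 * N by rewrite mulr_ge0 ?sqr_ge0 // ltW.
  nra.
- by rewrite scale_entropyK.
move=> k; apply: (@le_trans _ _ (expR (- scale_entropy (l + (k + 6))) * #|G|%:R)).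
  by rewrite ler_wpM2r ?ler0n // ler_expR lerN2.
by rewrite scale_entropyK /ball_card /r [(l + _)%N]/= exprD invfM mulrA.
Qed.

End Scale.

(** * Greedy selection of blocks *)

Section Greedy.
Context {R : realType}.

Lemma geometric_below (q c B : R) m : 1 < q -> 0 < c -> 0 <= B ->
  \sum_(j < m | c * q ^+ j <= B) c * q ^+ j <= B * (q / (q - 1)).
Proof.
move=> q1 c0 B0; have D0 : 0 <= q / (q - 1) by rewrite divr_ge0; lra.
elim: m => [|m IH]; first by rewrite big_ord0 mulr_ge0.
have [h|h] := leP (c * q ^+ m) B; last first.
  by rewrite big_mkcond big_ord_recr /= ifN ?addr0 -?big_mkcond // -ltNge.
apply: (@le_trans _ _ (\sum_(j < m.+1) c * q ^+ j)).
  rewrite big_mkcond; apply: ler_sum => j _; case: ifP => // _.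
  by rewrite mulr_ge0 ?exprn_ge0 //; lra.
rewrite -mulr_sumr mulrA ler_pdivlMr; last by lra.
rewrite -mulrA [_ * (q - 1)]mulrC -subrX1 exprS.
have : 0 <= c by lra.
have : c * q ^+ m * q <= B * q by rewrite ler_wpM2r //; lra.
by lra.
Qed.

Lemma geometric_below_seq (q c B : R) (Y : seq nat) : 1 < q -> 0 < c -> 0 <= B ->
  uniq Y -> (forall j, j \in Y -> c * q ^+ j <= B) ->
  \sum_(j <- Y) c * q ^+ j <= B * (q / (q - 1)).
Proof.
move=> q1 c0 B0 uY YB; pose m := (\max_(j <- Y) j).+1.
apply: le_trans (geometric_below m q1 c0 B0).
rewrite -(big_mkord (fun j => c * q ^+ j <= B) (fun j => c * q ^+ j)).
have Ym j : j \in Y -> (j < m)%N by move=> jY; rewrite ltnS; exact: leq_bigmax_seq.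
rewrite (perm_big [seq j <- index_iota 0 m | j \in Y]); last first.
  apply: uniq_perm; rewrite ?filter_uniq ?iota_uniq // => j; rewrite mem_filter mem_index_iota /=.
  by case: (boolP (j \in Y)) => // /Ym.
rewrite big_filter [X in _ <= X]big_mkcond [X in X <= _]big_mkcond.
apply: ler_sum => j _; case: ifP => [/YB->//|_].
by case: ifP => // _; rewrite mulr_ge0 ?exprn_ge0 //; lra.
Qed.

Lemma seq_argmax (T : nat -> R) (Y : seq nat) : Y != [::] ->
  exists2 x, x \in Y & forall y, y \in Y -> T y <= T x.
Proof.
elim: Y => // a [|b Y] IH _.
  by exists a; rewrite ?inE // => y; rewrite inE => /eqP->.
have [//|x xY hx] := IH.
have [h|/ltW h] := leP (T a) (T x).
  by exists x => [|y]; rewrite inE ?xY ?orbT // => /orP[/eqP->|/hx].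
exists a => [|y]; rewrite inE ?eqxx // => /orP[/eqP->//|/hx hy].
exact: le_trans hy h.
Qed.

Definition separated (k : R) (M : nat -> R) (I : seq nat) :=
  forall i j, i \in I -> j \in I -> i != j -> k * M i <= M j \/ k * M j <= M i.

(** Keep the [x] with the largest [T], discard every [j] with [M j] within a factor [k] of [M x],
    and repeat. A discarded [j] has [S j <= T x * k * c * q ^+ j / M x] and [c * q ^+ j < k * M x],
    so the geometric sum costs [k ^+ 2 * q / (q - 1)] times [T x]. *)
Lemma greedy_separated (k q c : R) (M T S : nat -> R) (X : seq nat) :
  1 < k -> 1 < q -> 0 < c -> uniq X ->
  (forall j, j \in X -> [/\ 0 <= T j, c * q ^+ j <= M j & S j <= T j * (c * q ^+ j / M j)]) ->
  exists I, [/\ uniq I, {subset I <= X}, separated k M I &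
    \sum_(j <- X) S j <= k ^+ 2 * (q / (q - 1)) * \sum_(j <- I) T j].
Proof.
move=> k1 q1 c0.
have D0 : 0 <= q / (q - 1) by rewrite divr_ge0; lra.
have [n] := ubnP (size X); elim: n X => // n IH X; rewrite ltnS => sX uX hX.
have [->|X0] := eqVneq X [::].
  by exists [::]; split => //; rewrite !big_nil mulr0.
have [x xX xmax] := seq_argmax T X0.
have M0 j : j \in X -> 0 < M j.
  by move=> /hX[_ h _]; apply: lt_le_trans h; rewrite mulr_gt0 ?exprn_gt0 //; lra.
pose far j := (k * M j <= M x) || (k * M x <= M j).
have Mx := M0 _ xX.
have farx : ~~ far x by rewrite /far orbb -ltNge; nra.
have sub2 : {subset [seq j <- X | far j] <= X} by move=> j; rewrite mem_filter => /andP[].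
have [|||I [uI IX Isep IS]] := IH [seq j <- X | far j].
- apply: leq_trans sX; rewrite size_filter ltn_neqAle count_size andbT -all_count.
  by apply: contraNN farx => /allP; apply.
- by rewrite filter_uniq.
- by move=> j /sub2 /hX.
exists (x :: I); split.
- rewrite /= uI andbT; apply: contraNN farx => /IX; rewrite mem_filter => /andP[]//.
- by move=> j; rewrite inE => /orP[/eqP->//|/IX/sub2].
- have farI j : j \in I -> far j by move=> /IX; rewrite mem_filter => /andP[].
  move=> i j; rewrite !inE => /orP[/eqP->|iI] /orP[/eqP->|jI] ij.
  + by rewrite eqxx in ij.
  + by case/orP: (farI _ jI) => ?; [right|left].
  + by case/orP: (farI _ iI) => ?; [left|right].
  + exact: Isep.
rewrite big_cons mulrDr (bigID far) /= -big_filter addrC lerD //.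
have Tx : 0 <= T x by have [] := hX _ xX.
apply: (@le_trans _ _ (\sum_(j <- X | ~~ far j) T x * (k / M x) * (c * q ^+ j))).
  rewrite big_seq_cond [X in _ <= X]big_seq_cond; apply: ler_sum => j /andP[jX].
  rewrite negb_or -!ltNge => /andP[h1 h2]; have [Tj cj Sj] := hX _ jX.
  apply: le_trans Sj _; have Mj := M0 _ jX.
  have cq : 0 < c * q ^+ j by rewrite mulr_gt0 ?exprn_gt0 //; lra.
  rewrite -[X in _ <= X]mulrA ler_pM ?divr_ge0 ?(ltW cq) ?(ltW Mj) ?xmax //.
  rewrite ler_pdivrMr //.
  have -> : k / M x * (c * q ^+ j) * M j = c * q ^+ j * (k * M j) / M x by ring.
  by rewrite ler_pdivlMr // ler_pM2l // ltW.
rewrite -mulr_sumr -big_filter.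
have : \sum_(j <- [seq j <- X | ~~ far j]) c * q ^+ j <= k * M x * (q / (q - 1)).
  apply: geometric_below_seq => //; first by rewrite mulr_ge0 ?ltW //; lra.
    by rewrite filter_uniq.
  move=> j; rewrite mem_filter negb_or -!ltNge => /andP[/andP[_ h] jX].
  by have [_ + _] := hX _ jX => /le_trans; apply; exact: ltW.
move=> h; apply: le_trans (ler_wpM2l _ h) _.
  by rewrite mulr_ge0 // divr_ge0 ?ltW //; lra.
have qn : q - 1 != 0 by rewrite gt_eqF // subr_gt0.
by rewrite le_eqVlt; apply/orP; left; apply/eqP; field; rewrite qn gt_eqF.
Qed.

End Greedy.

(** * The lower bound for all blocks together *)

Section Blocks.
Context {R : realType} (G : finZmodType) (K : finType) (C S : K -> G -> R) (d : K -> G -> R).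
Hypothesis C1 : forall k t, `|C k t| <= 1.
Hypothesis S1 : forall k t, `|S k t| <= 1.
Hypothesis dE : forall k s t, dist2 C S k s t = d k (s - t).
Variables (A : nat -> {set K}) (b : nat -> R).
Hypothesis Adisj : forall i j, i != j -> [disjoint A i & A j].
Hypothesis b0 : forall j, 0 <= b j.

(** Greedy selection applied to fourth roots of entropies, because the surplus in [scale_choice] is
    a fourth root. In the constant, 24 comes from [scale_choice], 128 from [stage_gain], and
    [4 ^+ 20] is the square of the separation ratio. *)
Lemma block_sum_le (q c : R) (J : seq nat) : 1 < q -> 0 < c -> uniq J ->
  (forall j, j \in J -> [/\ (0 < #|A j|)%N, 6 <= (c * q ^+ j) ^+ 4 &
    #|[set t | dset d (A j) t <= #|A j|%:R]|%:R <= expR (- (c * q ^+ j) ^+ 4) * #|G|%:R]) ->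
  exists2 I, uniq I & {subset I <= J} /\
   \sum_(j <- J) b j * (Num.sqrt #|A j|%:R * (c * q ^+ j) ^+ 2) <=
   (24 * 128) * 4 ^+ 20 * (q / (q - 1)) * avg (fun w => maxG (signal C S A b I w)).
Proof.
move=> q1 c0 uJ hJ; have cge0 := ltW c0; have q0 : 0 <= q by lra.
have cq j : 0 < c * q ^+ j by rewrite mulr_gt0 ?exprn_gt0 //; lra.
have /choice[f hf] : forall j, exists p : R * R * R, j \in J ->
  [/\ 0 <= p.1.1 <= 8^-1, 0 < p.1.2, (c * q ^+ j) ^+ 4 <= p.2, p.1.1 ^+ 2 * p.1.2 <= p.2 / 8 &
   [/\ #|A j|%:R ^+ 2 * (c * q ^+ j) ^+ 4 * p.2 <= (24 * (p.1.1 * p.1.2)) ^+ 4,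
    #|[set t | dset d (A j) t <= p.1.2]|%:R <= expR (- p.2) * #|G|%:R &
    forall l, expR (- (4 ^+ (6 * (l + 6)) * p.2)) * #|G|%:R <=
     #|[set t | dset d (A j) t <= p.1.2 / 4 ^+ (l + 6)]|%:R]].
  move=> j; have [jJ|jJ] := boolP (j \in J); last by exists (0, 0, 0).
  have [Aj0 g6 hg] := hJ _ jJ.
  have [lam [r [N h]]] := scale_choice C1 S1 dE Aj0 g6 hg.
  by exists (lam, r, N).
pose lam j := (f j).1.1; pose r j := (f j).1.2; pose N j := (f j).2.
pose M j := Num.sqrt (Num.sqrt (N j)).
have M4 j : j \in J -> M j ^+ 4 = N j.
  move=> /hf[_ _ h _ _]; rewrite (exprM (M j) 2 2) !sqr_sqrtr ?sqrtr_ge0 //.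
  by apply: le_trans h; rewrite exprn_ge0 // ltW.
have M0 j : 0 <= M j by rewrite sqrtr_ge0.
pose T j := 24 * (b j * (lam j * r j)).
pose Sj j := b j * (Num.sqrt #|A j|%:R * (c * q ^+ j) ^+ 2).
have [|j jJ|I [uI IJ Isep IS]] := @greedy_separated R (4 ^+ 10) q c M T Sj J _ q1 c0 uJ.
- by rewrite exprn_egt1 // ltr1n.
- have [_ g6 _] := hJ _ jJ; have [/andP[l0 _] r0 gN _ [h _ _]] := hf _ jJ.
  have cM : c * q ^+ j <= M j.
    by rewrite -(@ler_pXn2r _ 4) ?nnegrE ?M0 ?(ltW (cq j)) // M4.
  have Mj : 0 < M j := lt_le_trans (cq j) cM.
  split=> //; first by rewrite !mulr_ge0 ?(ltW r0).
  have -> : T j * (c * q ^+ j / M j) = b j * (24 * (lam j * r j) * (c * q ^+ j) / M j).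
    by rewrite /T; ring.
  rewrite /Sj ler_wpM2l // ler_pdivlMr //.
  have e4 : Num.sqrt (#|A j|%:R : R) ^+ 4 = #|A j|%:R ^+ 2.
    by rewrite (exprM _ 2 2) sqr_sqrtr.
  rewrite -(@ler_pXn2r _ 4) ?nnegrE ?mulr_ge0 ?sqrtr_ge0 ?exprn_ge0 ?(ltW (cq j)) ?(ltW r0) //.
  rewrite exprMn (exprMn _ (Num.sqrt _)) e4 M4 // (exprMn _ (24 * _)).
  apply: le_trans (ler_wpM2r (exprn_ge0 4 (ltW (cq j))) h).
  by rewrite le_eqVlt; apply/orP; left; apply/eqP; rewrite -/(N j); ring.
(* The fourth power of the ratio [4 ^+ 10] exceeds the [4 ^+ 37] required by the chain. *)
have sep4 i j : i \in J -> j \in J -> 4 ^+ 10 * M i <= M j -> 4 ^+ 37 * N i <= N j.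
  move=> iJ jJ h; rewrite -!M4 //.
  apply: (@le_trans _ _ ((4 ^+ 10 * M i) ^+ 4)); last first.
    by rewrite lerXn2r ?nnegrE ?mulr_ge0 ?exprn_ge0.
  by rewrite exprMn -exprM ler_wpM2r ?exprn_ge0 // ler_weXn2l // ler1n.
pose I' := sort (fun i j => M i <= M j) I.
have uI' : uniq I' by rewrite sort_uniq.
have memI' : I' =i I := mem_sort _ _.
have srt : sorted (fun i j => 4 ^+ 37 * N i <= N j) I'.
  apply: pairwise_sorted.
  have p1 : pairwise (fun i j => M i <= M j) I'.
    rewrite -sorted_pairwise; last by move=> x y z; exact: le_trans.
    by apply: sort_sorted => x y; exact: le_total.
  have p2 : pairwise (fun i j => i != j) I' by rewrite -uniq_pairwise.
  have : pairwise (fun i j => (M i <= M j) && (i != j)) I' by rewrite pairwise_relI p1.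
  apply: (@sub_in_pairwise _ (mem I')); last exact/allP.
  move=> i j /=; rewrite !memI' => iI jI /andP[ij inj].
  have [iJ jJ] := (IJ _ iI, IJ _ jI).
  case: (Isep i j iI jI inj) => h; first exact: sep4.
  have Mj : 0 < M j.
    have [_ g6 _] := hJ _ jJ; have [_ _ gN _ _] := hf _ jJ.
    by rewrite !sqrtr_gt0; apply: lt_le_trans gN; lra.
  have : 1 * M j < 4 ^+ 10 * M j by rewrite ltr_pM2r // exprn_egt1 // ltr1n.
  by lra.
exists I'; first by [].
split; first by move=> j; rewrite memI' => /IJ.
have [|kb [kbP _ kbV]] := @chain_value R G K C S d C1 S1 dE A b lam r N [::] I' _ srt Adisj uI'.
  move=> j /=; rewrite memI' => /IJ jJ.
  have [_ g6 _] := hJ _ jJ; have [l08 r0 gN lr [h h1 h2]] := hf _ jJ.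
  by split; split=> //; apply: le_trans g6 gN.
have := kbV 0 (fun=> 0); rewrite (ex_cst (kbP 0)) addr0.
rewrite (_ : avg _ = avg (fun w => maxG (signal C S A b I' w))); last first.
  by apply: eq_avg => w; congr maxG; apply/funext => t; rewrite addr0.
move=> hV; apply: le_trans IS _.
have -> : \sum_(j <- I) T j = (24 * 128) * \sum_(j <- I') (b j * lam j * r j / 128).
  rewrite (perm_big I') /=; last by rewrite perm_sym perm_sort perm_refl.
  by rewrite mulr_sumr; apply: eq_bigr => j _; rewrite /T; lra.
rewrite -exprM.
have -> : (24 * 128) * 4 ^+ 20 * (q / (q - 1)) * avg (fun w => maxG (signal C S A b I' w)) =
  4 ^+ 20 * (q / (q - 1)) * ((24 * 128) * avg (fun w => maxG (signal C S A b I' w))) by ring.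
rewrite ler_wpM2l ?mulr_ge0 ?exprn_ge0 ?invr_ge0 //; [lra|].
apply: ler_wpM2l hV; exact: mulr_ge0.
Qed.

End Blocks.

(** * Even moments and grid averages *)

Section Complex.
Context {R : realType}.
Local Notation cnorm := (@Normc.normc R).

Lemma sqr_cnorm (a b : R) : cnorm (a +i* b)%C ^+ 2 = a ^+ 2 + b ^+ 2.
Proof. by rewrite /= sqr_sqrtr // addr_ge0 ?sqr_ge0. Qed.

Lemma cnorm_ge0 (z : R[i]) : 0 <= cnorm z.
Proof. by case: z => a b; exact: sqrtr_ge0. Qed.

Lemma cnormX (z : R[i]) n : cnorm (z ^+ n) = cnorm z ^+ n.
Proof.
by elim: n => [|n IH]; rewrite ?expr0 ?Normc.normc1 // !exprS Normc.normcM IH.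
Qed.

Lemma sum_complex (I : Type) (r : seq I) (P : pred I) (a b : I -> R) :
  \sum_(i <- r | P i) (a i +i* b i)%C =
  ((\sum_(i <- r | P i) a i) +i* (\sum_(i <- r | P i) b i))%C.
Proof. by elim/big_rec3: _ => // i x y z _ ->. Qed.

Lemma charD k l (x : R) : char (k + l) x = char k x * char l x.
Proof.
rewrite /char natrD mulrDr mulrDl cosD sinD.
by apply/eqP; rewrite eq_complex /=; apply/andP; split; apply/eqP; ring.
Qed.

Lemma char0 (x : R) : char 0 x = 1.
Proof. by rewrite /char mulr0 mul0r cos0 sin0. Qed.

Lemma charE k (x : R) : char k x = char 1 x ^+ k.
Proof. by elim: k => [|k IH]; rewrite ?char0 // exprS -IH -charD add1n. Qed.

(** The squared modulus of [q] at [char 1 x], expanded into cosines so that it can be integrated and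
    summed as a real function. *)
Definition sqmod (q : {poly R}) (x : R) : R :=
  \sum_(i < size q) \sum_(j < size q) q`_i * q`_j * cos (2 * pi * (i%:R - j%:R) * x).

Lemma sqr_cnorm_horner (q : {poly R}) x :
  cnorm ((map_poly (real_complex R) q).[char 1 x]) ^+ 2 = sqmod q x.
Proof.
rewrite horner_coef size_map_poly.
under eq_bigr => i _.
  rewrite coef_map /= -charE /char.
  have -> : (q`_i)%:C%C * (cos (2 * pi * i%:R * x) +i* sin (2 * pi * i%:R * x))%C
     = ((q`_i * cos (2 * pi * i%:R * x)) +i* (q`_i * sin (2 * pi * i%:R * x)))%C.
    by apply/eqP; rewrite eq_complex /= !mul0r subr0 addr0 !eqxx.
  over.
rewrite sum_complex sqr_cnorm !expr2 !big_distrlr -big_split; apply: eq_bigr => i _.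
rewrite -big_split; apply: eq_bigr => j _ /=.
rewrite mulrBr mulrBl cosB; ring.
Qed.

End Complex.

(** * Parseval's identity on the torus *)

Section FourierIntegral.
Context {R : realType}.

Lemma cos2pin n : cos (2 * pi * n%:R) = 1 :> R.
Proof.
elim: n => [|n IH]; first by rewrite mulr0 cos0.
by rewrite -(natr1 n) mulrDr mulr1 [X in _ + X]mulr_natl cosD2pi.
Qed.

Lemma sin2pin n : sin (2 * pi * n%:R) = 0 :> R.
Proof.
elim: n => [|n IH]; first by rewrite mulr0 sin0.
by rewrite -(natr1 n) mulrDr mulr1 [X in _ + X]mulr_natl sinD2pi.
Qed.

Lemma sin2pinB i j : sin (2 * pi * (i%:R - j%:R)) = 0 :> R.
Proof. by rewrite mulrBr sinB !sin2pin mul0r mulr0 subrr. Qed.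

Definition wave (w x : R) : R := cos (w * x).
Definition wave_primitive (w x : R) : R := if w == 0 then x else w^-1 * sin (w * x).

Lemma is_derive_scale (w x : R) : is_derive x 1 (fun y : R => w * y) w.
Proof. by apply: is_derive_eq; rewrite /= ; first exact: mulr1. Qed.

Lemma is_derive_wave (w x : R) : is_derive x 1 (wave w) (- sin (w * x) * w).
Proof.
exact: (@is_derive1_comp R cos (fun y => w * y) x _ _ (is_derive_cos _) (is_derive_scale w x)).
Qed.

Lemma is_derive_wave_primitive (w x : R) : is_derive x 1 (wave_primitive w) (wave w x).
Proof.
rewrite /wave_primitive /wave; have [->|w0] := eqVneq w 0.
  by rewrite mul0r cos0; exact: is_derive_id.
have h := @is_derive1_comp R sin (fun y => w * y) x _ _ (is_derive_sin _) (is_derive_scale w x).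
have -> : cos (w * x) = w^-1 * (cos (w * x) * w) by rewrite mulrCA mulVf ?mulr1.
exact: (is_deriveZ (w^-1) h).
Qed.

Variable q : {poly R}.
Let w (i j : 'I_(size q)) : R := 2 * pi * (i%:R - j%:R).

Definition sqmod_primitive (x : R) : R :=
  \sum_(i < size q) \sum_(j < size q) q`_i * q`_j * wave_primitive (w i j) x.

Lemma is_derive_double_sum (f g : R -> R -> R) (x : R) :
  (forall v, is_derive x 1 (f v) (g v x)) ->
  is_derive x 1 (fun y : R => \sum_(i < size q) \sum_(j < size q) q`_i * q`_j * f (w i j) y)
    (\sum_(i < size q) \sum_(j < size q) q`_i * q`_j * g (w i j) x).
Proof.
move=> fg.
have -> : (fun y : R => \sum_(i < size q) \sum_(j < size q) q`_i * q`_j * f (w i j) y) =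
  \sum_(i < size q) \sum_(j < size q) ((q`_i * q`_j) \*: f (w i j)).
  apply/funext => y; rewrite fct_sumE; apply: eq_bigr => i _.
  by rewrite fct_sumE; apply: eq_bigr => j _.
apply: is_derive_sum => i; apply: is_derive_sum => j; apply: is_deriveZ; exact: fg.
Qed.

Lemma integral_sqmod :
  (\int[@lebesgue_measure R]_(x in `[(0:R)%R, (1:R)%R]%classic) (sqmod q x)%:E = (\sum_(i < size q) q`_i ^+ 2)%:E)%E.
Proof.
have dS (x : R) := @is_derive_double_sum wave (fun v y => - sin (v * y) * v) x (is_derive_wave^~ x).
have dP (x : R) := @is_derive_double_sum wave_primitive wave x (is_derive_wave_primitive^~ x).
rewrite (@continuous_FTC2 R (sqmod q) sqmod_primitive 0 1) //.
- rewrite -EFinB; congr EFin; rewrite /sqmod_primitive -sumrB; apply: eq_bigr => i _.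
  rewrite -sumrB (bigD1 i) //= big1 ?addr0; last first.
    move=> j ji; rewrite /wave_primitive; case: eqP => [/eqP|_]; last first.
      by rewrite mulr1 mulr0 sin2pinB sin0 subrr.
    rewrite mulf_eq0 mulf_eq0 pnatr_eq0 /= gt_eqF ?pi_gt0 //= subr_eq0 eqr_nat.
    by move=> /eqP/val_inj e; rewrite e eqxx in ji.
  by rewrite /wave_primitive /w subrr mulr0 eqxx mulr0 mulr1 subr0 expr2.
- by apply: derivable_within_continuous => x _; have [] := dS x.
- have cP (x : R) : {for x, continuous sqmod_primitive}.
    by apply: differentiable_continuous; apply/derivable1_diffP; have [] := dP x.
  split; first by move=> x _; have [] := dP x.
    by apply: cvg_at_right_filter; exact: cP.
  by apply: cvg_at_left_filter; exact: cP.
- by move=> x _; rewrite derive1E; have [_] := dP x.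
Qed.

Lemma continuous_sqmod : continuous (sqmod q).
Proof.
move=> x; apply: differentiable_continuous; apply/derivable1_diffP.
by have [] := @is_derive_double_sum wave (fun v y => - sin (v * y) * v) x (is_derive_wave^~ x).
Qed.

End FourierIntegral.

Section Haar.
Context {R : realType}.
Local Open Scope ereal_scope.

Lemma ge0_integral_haar (f : measurableTypeR R -> \bar R) : measurable_fun setT f -> (forall x, 0 <= f x) ->
  \int[haar R]_x f x = \int[@lebesgue_measure R]_(x in `[(0:R)%R, (1:R)%R]%classic) f x.
Proof.
move=> mf f0; have mI : measurable (`[(0:R)%R, (1:R)%R[%classic : set (measurableTypeR R)) by exact: measurable_itv.
rewrite (@ge0_negligible_integral _ _ _ (haar R) setT (~` `[(0:R)%R, (1:R)%R[%classic)) //; last 2 first.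
- exact: measurableC.
- by rewrite /haar /= /mrestr setICl measure0.
rewrite setTD setCK (@eq_measure_integral _ _ _ _ lebesgue_measure); last first.
  by move=> A mA AI; rewrite /haar /= /mrestr setIidl.
rewrite integral_itv_bndo_bndc //; exact: measurable_funTS.
Qed.

Lemma haar_setT : haar R setT = 1.
Proof. by rewrite /haar /= /mrestr setTI lebesgue_measure_itv /= lte_fin ltr01 oppr0 adde0. Qed.

(** For an even exponent the integrand is the squared modulus of a polynomial, and Parseval's
    identity applies. *)
Lemma Lqnorm_even (f : R -> R[i]) (q : {poly R}) (s : nat) : (0 < s)%N ->
  (forall x, Normc.normc (f x) ^+ (2 * s) = sqmod q x)%R ->
  Lqnorm (2 * s)%:R%:E f = ((\sum_(i < size q) q`_i ^+ 2) `^ (2 * s)%:R^-1)%:E.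
Proof.
move=> s0 fq; rewrite /Lqnorm unlock /= -poweR_EFin -integral_sqmod; congr (_ `^ _).
transitivity (\int[haar R]_x (sqmod q x)%:E).
  apply: eq_integral => x _.
  by rewrite /= powR_mulrn // ger0_norm ?fq // cnorm_ge0.
rewrite ge0_integral_haar //.
  apply/measurable_EFinP; apply: continuous_measurable_fun; exact: continuous_sqmod.
by move=> x; rewrite lee_fin -fq exprn_ge0 // cnorm_ge0.
Qed.

End Haar.

(** * Parseval's identity on a grid *)

Section Grid.
Context {R : realType}.

(** The terms telescope, each being the difference of two sines. *)
Lemma dirichlet_sum (h : R) m :
  2 * sin h * \sum_(t < m) cos (2 * h * t%:R) = sin ((2 * m%:R - 1) * h) + sin h.
Proof.
elim: m => [|m IH]; first by rewrite big_ord0 !mulr0 sub0r mulN1r sinN addNr.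
rewrite big_ord_recr /= mulrDr IH -(natr1 m).
have -> : (2 * (m%:R + 1) - 1) * h = 2 * h * m%:R + h by ring.
have -> : (2 * m%:R - 1) * h = 2 * h * m%:R - h by ring.
rewrite sinB sinD; ring.
Qed.

Lemma sum_cos_grid n M : (0 < n)%N -> (n < M)%N ->
  \sum_(t < M) cos (2 * pi * n%:R * (t%:R / M%:R)) = 0 :> R.
Proof.
move=> n0 nM; have Mn : (0 < M)%N by exact: leq_ltn_trans nM.
have M0 : 0 < M%:R :> R by rewrite ltr0n.
pose h : R := pi * n%:R / M%:R.
have sh : 0 < sin h.
  apply: sin_gt0_pi; rewrite divr_gt0 ?mulr_gt0 ?pi_gt0 ?ltr0n //=.
  by rewrite ltr_pdivrMr // ltr_pM2l ?pi_gt0 // ltr_nat.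
have := dirichlet_sum h M.
have -> : (2 * M%:R - 1) * h = 2 * pi * n%:R - h by rewrite /h; field; rewrite gt_eqF.
rewrite sinB sin2pin cos2pin mul0r mul1r sub0r addNr => /eqP.
rewrite mulf_eq0 mulf_eq0 pnatr_eq0 /= (gt_eqF sh) /= => /eqP e; rewrite -[RHS]e.
by apply: eq_bigr => t _; congr cos; rewrite /h; field; rewrite gt_eqF.
Qed.

(** Two distinct exponents differ by less than [M], so there is no aliasing and the cross terms
    vanish by [sum_cos_grid]. *)
Lemma grid_sqmod (q : {poly R}) M : (0 < M)%N -> (size q <= M)%N ->
  \sum_(t < M) sqmod q (t%:R / M%:R) = M%:R * \sum_(i < size q) q`_i ^+ 2.
Proof.
move=> M0 qM; rewrite /sqmod exchange_big mulr_sumr; apply: eq_bigr => i _ /=.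
rewrite exchange_big (bigD1 i) //= [X in _ + X]big1 ?addr0; last first.
  move=> j ji; rewrite -mulr_sumr.
  have [h|h|/val_inj h] := ltngtP i j; last by rewrite h eqxx in ji.
    apply/eqP; rewrite mulf_eq0; apply/orP; right; apply/eqP.
    rewrite -[RHS](@sum_cos_grid (j - i) M) ?subn_gt0 //; last first.
      by apply: leq_ltn_trans (leq_subr _ _) (leq_trans (ltn_ord j) qM).
    by apply: eq_bigr => t _; rewrite -cosN natrB 1?ltnW //; congr cos; ring.
  apply/eqP; rewrite mulf_eq0; apply/orP; right; apply/eqP.
  rewrite -[RHS](@sum_cos_grid (i - j) M) ?subn_gt0 //; last first.
    by apply: leq_ltn_trans (leq_subr _ _) (leq_trans (ltn_ord i) qM).
  by apply: eq_bigr => t _; rewrite natrB 1?ltnW.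
under eq_bigr do rewrite subrr mulr0 mul0r cos0 mulr1.
by rewrite sumr_const card_ord -[LHS]mulr_natl expr2.
Qed.

End Grid.

Section Moments.
Context {R : realType}.
Local Notation cnorm := (@Normc.normc R).

Definition idempotent (F : {fset nat}) : coefs R := [fsfun k in F => 1 : R[i]].

Lemma finsupp_idempotent F : finsupp (idempotent F) = F.
Proof. by apply/fsetP => k; rewrite mem_finsupp fsfunE; case: ifP; rewrite ?oner_eq0 ?eqxx. Qed.

Definition idempotent_poly (F : {fset nat}) : {poly R} := \sum_(k <- F) 'X^k.

Lemma trigpoly_idempotent F x :
  trigpoly (idempotent F) x = (map_poly (real_complex R) (idempotent_poly F)).[char 1 x].
Proof.
rewrite /trigpoly finsupp_idempotent /idempotent_poly rmorph_sum horner_sum.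
apply: eq_big_seq => k kF.
by rewrite fsfunE kF mul1r rmorphXn /= map_polyX hornerXn charE.
Qed.

Lemma size_idempotent_poly F m : (forall k, k \in F -> (k < m)%N) ->
  (size (idempotent_poly F) <= m)%N.
Proof.
move=> Fm; apply: leq_trans (size_sum _ _ _) _; apply/bigmax_leqP_seq => k kF _.
by rewrite size_polyXn Fm.
Qed.

Lemma coef_idempotent_poly F i : (idempotent_poly F)`_i = (i \in F)%:R.
Proof.
rewrite coef_sum; have [iF|iF] := boolP (i \in F).
  rewrite (bigD1_seq i iF (fset_uniq F)) /=.
  rewrite coefXn eqxx big1 ?addr0 // => k ki.
  by rewrite coefXn eq_sym (negbTE ki).
rewrite big_seq big1 // => k kF; rewrite coefXn.
by case: eqP => // e; rewrite e kF in iF.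
Qed.

Lemma sum_sqr_idempotent F :
  \sum_(i < size (idempotent_poly F)) (idempotent_poly F)`_i ^+ 2 = #|` F|%:R.
Proof.
set q := idempotent_poly F.
have Fq k : k \in F -> (k < size q)%N.
  move=> kF; rewrite ltnNge; apply/negP => h.
  by have := coef_idempotent_poly F k; rewrite -/q nth_default // kF => /esym/eqP; rewrite oner_eq0.
rewrite -(big_mkord xpredT (fun i => q`_i ^+ 2)).
rewrite (eq_bigr (fun i => (i \in F)%:R)); last first.
  by move=> i _; rewrite coef_idempotent_poly; case: (i \in F); rewrite ?expr1n ?expr0n.
rewrite -natr_sum; congr _%:R.
rewrite -(big_mkcond (fun i => i \in F)) /= -big_filter sum1_size.
apply: perm_size; apply: uniq_perm => //.
- by rewrite filter_uniq // iota_uniq.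
- exact: fset_uniq.
- by move=> k; rewrite mem_filter mem_index_iota /=; case: (boolP (k \in F)) => //= /Fq ->.
Qed.

Lemma cnorm_idempotent F s x :
  cnorm (trigpoly (idempotent F) x) ^+ (2 * s) = sqmod (idempotent_poly F ^+ s) x.
Proof.
by rewrite trigpoly_idempotent mulnC exprM -cnormX -horner_exp -rmorphXn sqr_cnorm_horner.
Qed.

(** The power |f|^(2s) is the squared modulus of f^s, whose degree is below [M]. Its grid average
    therefore equals its integral, which the hypothesis for [q = 2 * s] bounds. *)
Lemma moment_bound (L : set nat) (C alpha : R) (F : {fset nat}) (s m M : nat) :
  (forall (q : R) (a : coefs R), 2 < q -> spectrum_in L a ->
      (Lqnorm q%:E (trigpoly a)
         <= (C * q `^ alpha)%:E * Lqnorm 2%:E (trigpoly a))%E) ->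
  ([set` F] `<=` L)%classic -> (1 < s)%N -> (forall k, k \in F -> (k < m)%N) -> (s * m < M)%N ->
  \sum_(t < M) cnorm (\sum_(k <- F) char k (t%:R / M%:R)) ^+ (2 * s) <=
    M%:R * (C * (2 * s)%:R `^ alpha * Num.sqrt #|` F|%:R) ^+ (2 * s).
Proof.
move=> hL FL s1 Fm smM.
have s0 : (0 < s)%N by exact: ltnW.
set c := \sum_(i < size (idempotent_poly F ^+ s)) (idempotent_poly F ^+ s)`_i ^+ 2.
have c0 : 0 <= c by apply: sumr_ge0 => i _; exact: sqr_ge0.
have := hL (2 * s)%:R (idempotent F).
rewrite ltr_nat -[X in (X < _)%N]muln1 ltn_pmul2l // /spectrum_in finsupp_idempotent => /(_ s1 FL).
rewrite (Lqnorm_even s0 (cnorm_idempotent F s)) -/c.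
have := Lqnorm_even (isT : (0 < 1)%N) (cnorm_idempotent F 1).
rewrite muln1 expr1 sum_sqr_idempotent => ->; rewrite -EFinM lee_fin powR12_sqrt // => h.
have sz : (size (idempotent_poly F ^+ s) <= M)%N.
  apply: leq_trans (size_poly_exp_leq _ _) _; apply: leq_ltn_trans smM.
  rewrite mulnC leq_mul2l; apply/orP; right.
  by have := size_idempotent_poly Fm; case: (size _) => // n /ltnW.
rewrite (eq_bigr (fun t : 'I_M => sqmod (idempotent_poly F ^+ s) (t%:R / M%:R))); last first.
  move=> t _; rewrite -cnorm_idempotent; congr (cnorm _ ^+ _).
  rewrite /trigpoly finsupp_idempotent; apply: eq_big_seq => k kF.
  by rewrite fsfunE kF mul1r.
rewrite grid_sqmod //; last by apply: leq_ltn_trans smM.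
rewrite ler_wpM2l // -/c.
have e : c = (c `^ (2 * s)%:R^-1) ^+ (2 * s).
  rewrite -powR_mulrn ?powR_ge0 // -powRrM mulVf ?powRr1 //.
  by rewrite pnatr_eq0 -lt0n muln_gt0 s0.
rewrite [leLHS]e lerXn2r ?nnegrE ?powR_ge0 //.
  by apply: le_trans h; exact: powR_ge0.
Qed.

End Moments.

(** * Contraction and the Pisier norm *)

Section Contraction.
Context {R : realType} (K : finType) (N : (K -> R) -> R).
Hypothesis N_convex : forall (c : R) x y, 0 <= c <= 1 ->
  N (fun k => c * x k + (1 - c) * y k) <= c * N x + (1 - c) * N y.
Local Notation O := {ffun K -> bool * bool}.

(** Contraction principle, one coordinate at a time: a sign times [theta] is the mean of the sign
    and its opposite with weights [(1 + theta) / 2] and [(1 - theta) / 2], and the flip preserves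
    the uniform measure. The multipliers may depend on [w], though not on its signs. *)
Lemma sign_contraction (theta : O -> K -> R) :
  (forall w k, 0 <= theta w k <= 1) -> (forall k w, theta (flips k w) = theta w) ->
  avg (fun w : O => N (fun k => (-1) ^+ (w k).1 * theta w k)) <=
  avg (fun w : O => N (fun k => (-1) ^+ (w k).1)).
Proof.
move=> t01 tflip.
pose x (D : seq K) (w : O) k := (-1) ^+ (w k).1 * (if k \in D then theta w k else 1).
suff H D : uniq D -> avg (fun w => N (x D w)) <= avg (fun w => N (x [::] w)).
  have := H (enum K) (enum_uniq _); congr (_ <= _); apply: eq_avg => w; congr N; apply/funext => k.
    by rewrite /x mem_enum.
  by rewrite /x in_nil mulr1.
elim: D => // a D IH /andP[aD uD]; apply: le_trans (IH uD).
have xflip k w : x D (flips a w) k = if k == a then - x D w k else x D w k.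
  rewrite /x tflip ffunE; case: eqP => // ->.
  by rewrite (negbTE aD) !mulr1 /=; case: (w a).1; rewrite ?expr1 ?expr0 ?opprK.
apply: (@le_trans _ _ (avg (fun w => (1 + theta w a) / 2 * N (x D w)) +
    avg (fun w => (1 - theta w a) / 2 * N (x D (flips a w))))).
  rewrite -avgD; apply: avg_le => w.
  have -> : (1 - theta w a) / 2 = 1 - (1 + theta w a) / 2 by lra.
  have -> : x (a :: D) w = fun k => (1 + theta w a) / 2 * x D w k +
      (1 - (1 + theta w a) / 2) * x D (flips a w) k.
    apply/funext => k; rewrite xflip; case: eqP => [->|/eqP ka].
      by rewrite /x inE eqxx (negbTE aD) /=; field.
    by rewrite /x inE (negbTE ka) /=; field.
  by apply: N_convex; have := t01 w a; lra.
rewrite [X in _ + X](avg_reindex _ (@flips_inj _ a)) -avgD le_eqVlt; apply/orP; left; apply/eqP.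
apply: eq_avg => w /=; rewrite tflip.
have -> : flips a (flips a w) = w.
  by apply/ffunP => i; rewrite !ffunE; case: eqP => // _; rewrite negbK; case: (w i).
by field.
Qed.

Lemma avg_marginal (g : {ffun K -> bool} -> R) :
  avg (fun w : O => g [ffun k => (w k).1]) = avg g.
Proof.
pose h (p : {ffun K -> bool} * {ffun K -> bool}) : O := [ffun k => (p.1 k, p.2 k)].
pose h' (w : O) : {ffun K -> bool} * {ffun K -> bool} := ([ffun k => (w k).1], [ffun k => (w k).2]).
have hK : cancel h h'.
  by move=> [u v]; congr pair; apply/ffunP => k; rewrite !ffunE.
have h'K : cancel h' h.
  by move=> w; apply/ffunP => k; rewrite !ffunE; case: (w k).
have c0 : #|{: {ffun K -> bool}}|%:R != 0 :> R.
  by rewrite pnatr_eq0 -lt0n; apply/card_gt0P; exists [ffun=> true].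
have cO : #|{: O}| = (#|{: {ffun K -> bool}}| * #|{: {ffun K -> bool}}|)%N.
  by rewrite -card_prod; apply: (bij_eq_card (f := h')); exists h.
rewrite /avg cO natrM invfM -mulrA; congr (_ * _).
rewrite (reindex h) /=; last by apply: onW_bij; exists h'.
rewrite (eq_bigr (fun p : {ffun K -> bool} * {ffun K -> bool} => g p.1)); last first.
  by move=> [u v] _ /=; congr g; apply/ffunP => k; rewrite !ffunE.
rewrite -(pair_bigA _ (fun u _ => g u)) /=.
under eq_bigr do rewrite sumr_const -mulr_natl.
by rewrite -mulr_sumr mulKf.
Qed.

End Contraction.

(** * Grid values against the essential supremum *)

Section EssSup.
Context {R : realType}.
Local Notation cnorm := (@Normc.normc R).

(** Such an integral is a supremum over the simple functions below the integrand. In this form it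
    applies directly to the integrand of the Pisier norm. *)
Lemma ge0_le_integralT d (T : measurableType d) (mu : {measure set T -> \bar R})
    (f g : T -> \bar R) : (forall x, 0 <= f x)%E -> (forall x, f x <= g x)%E ->
  (\int[mu]_x f x <= \int[mu]_x g x)%E.
Proof.
move=> f0 fg; have g0 x : (0 <= g x)%E := le_trans (f0 x) (fg x).
rewrite !ge0_integralTE //; apply: le_ereal_sup => _ [h hf <-]; exists h => // x.
exact: le_trans (hf x) (fg x).
Qed.

(** By continuity, a value above the essential supremum would persist on an interval to the right of
    [x0] inside [0, 1[, which has positive measure. *)
Lemma le_ess_sup_haar (f : R -> R[i]) (x0 : R) :
  continuous (cnorm \o f) -> 0 <= x0 < 1 -> ((cnorm (f x0))%:E <= Lqnorm +oo f)%E.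
Proof.
move=> fc /andP[x00 x01].
(* The norm of exponent [+oo] unfolds to an essential supremum once the total mass is known to be
   positive. *)
rewrite /Lqnorm unlock haar_setT lte01.
set g := abse \o _; set v := ess_sup _ _.
have gE x : g x = (cnorm (f x))%:E by rewrite /g /= ger0_norm ?cnorm_ge0.
rewrite -gE leNgt; apply/negP => vg.
have [N [mN N0 gN]] := ess_sup_ge (haar R) g.
have : \forall x \near x0, (v < g x)%E.
  move: vg; rewrite gE; case: v {gN} => [r|//|_]; last by near=> x; rewrite gE ltNyr.
  rewrite lte_fin => rg; near=> x; rewrite gE lte_fin; near: x.
  exact: (cvgr_gt _ (fc x0)).
move=> /nbhs_ballP[e /= e0 he].
pose y := Num.min (x0 + e) 1.
have xy : x0 < y by rewrite lt_min x01 ltrDl e0.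
have sub : (`[x0, y[ `<=` N `&` `[0%R, 1%R[)%classic.
  move=> x /=; rewrite in_itv /= => /andP[h1]; rewrite lt_min => /andP[h2 h3].
  split; last by rewrite in_itv /= h3 andbT (le_trans x00).
  apply: gN => /=; apply/negP; rewrite -ltNge; apply: he.
  by rewrite /ball /= ltr_norml; apply/andP; split; lra.
have : (lebesgue_measure (`[x0, y[%classic : set R) <= haar R N)%E.
  rewrite /haar /= /mrestr; apply: le_measure => //; rewrite inE.
    exact: measurable_itv.
  by apply: measurableI => //; exact: measurable_itv.
rewrite N0 lebesgue_measure_itv /= lte_fin xy -EFinB lee_fin; lra.
Unshelve. all: by end_near.
Qed.

Lemma continuous_cnorm_trig (s : seq nat) (c : nat -> R[i]) :
  continuous (cnorm \o (fun x => \sum_(k <- s) c k * char k x)).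
Proof.
pose cC (f : R -> R[i]) := continuous (fun x => complex.Re (f x)) /\ continuous (fun x => complex.Im (f x)).
have cc k : cC (fun x => c k * char k x).
  have ccos : continuous (fun x : R => cos (2 * pi * k%:R * x)).
    by move=> x; apply: (@continuous_comp _ _ _ (fun y => 2 * pi * k%:R * y) cos);
      [exact: mulrl_continuous|exact: continuous_cos].
  have csin : continuous (fun x : R => sin (2 * pi * k%:R * x)).
    by move=> x; apply: (@continuous_comp _ _ _ (fun y => 2 * pi * k%:R * y) sin);
      [exact: mulrl_continuous|exact: continuous_sin].
  case: (c k) => a b; split=> x /=.
    by apply: cvgB; apply: cvgM; try exact: cvg_cst; [exact: ccos|exact: csin].
  by apply: cvgD; apply: cvgM; try exact: cvg_cst; [exact: csin|exact: ccos].
have [cR cI] : cC (fun x => \sum_(k <- s) c k * char k x).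
  elim: s => [|k s [IR II]].
    by split=> x; under eq_fun do rewrite big_nil; exact: cst_continuous.
  have [kR kI] := cc k.
  split=> x; under eq_fun do rewrite big_cons raddfD /=.
    by apply: continuousD; [exact: kR|exact: IR].
  by apply: continuousD; [exact: kI|exact: II].
move=> x.
pose h (y : R) := complex.Re (\sum_(k <- s) c k * char k y) ^+ 2 +
  complex.Im (\sum_(k <- s) c k * char k y) ^+ 2.
have -> : cnorm \o (fun x => \sum_(k <- s) c k * char k x) = Num.sqrt \o h.
  by apply/funext => y; rewrite /h /=; case: (\sum_(k <- s) _).
apply: (@continuous_comp _ _ _ h Num.sqrt); last exact: sqrt_continuous.
by apply: cvgD; rewrite /continuous_at !expr2; apply: cvgM; first [exact: cR | exact: cI].
Qed.

End EssSup.

Section Pisier.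
Context {R : realType} (d : measure_display) (T : measurableType d) (P : probability T R).
Variable eps : nat -> {RV P >-> R}.
Hypothesis heps : rademacher eps.
Local Notation cnorm := (@Normc.normc R).

Variables (a : coefs R) (ks : seq nat).
Hypothesis ks_uniq : uniq ks.
Hypothesis ks_supp : finsupp a =i ks.
Hypothesis ks_pos : forall k, k \in ks -> (0 < k)%N.
Local Notation m := (size ks).

Definition sign_at (s : {ffun 'I_m -> bool}) (k : nat) : R :=
  (-1) ^+ [exists i : 'I_m, (nth 0%N ks i == k) && s i].

Lemma sign_at_nth s (i : 'I_m) : sign_at s (nth 0%N ks i) = (-1) ^+ s i.
Proof.
congr (_ ^+ nat_of_bool _); apply/existsP/idP => [[j /andP[]]|si]; last by exists i; rewrite eqxx.
by rewrite nth_uniq // => /eqP/val_inj ->.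
Qed.

Definition sign_event (s : {ffun 'I_m -> bool}) : set T :=
  (\bigcap_(k in [set` finsupp a]) eps k @^-1` [set sign_at s k])%classic.

Lemma measurable_sign_event s : measurable (sign_event s).
Proof.
apply: fin_bigcap_measurable; first exact: finite_fset.
move=> k _; rewrite -[X in measurable X]setTI.
by apply: measurable_funP => //; exact: measurable_set1.
Qed.

Lemma prob_sign_event s : P (sign_event s) = (2^-1 ^+ m)%:E.
Proof.
have [h1 h2] := heps.
have sub : ([set` finsupp a] `<=` [set k | (0 < k)%N])%classic.
  by move=> k /=; rewrite ks_supp => /ks_pos.
rewrite /sign_event (h2 _ (fun k => [set sign_at s k]%classic) sub); last first.
  by move=> k; exact: measurable_set1.
have -> : (\prod_(k <- finsupp a) P (eps k @^-1` [set sign_at s k])%classic)%E =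
   (\prod_(k <- finsupp a) (2^-1 : R)%:E)%E.
  apply: eq_big_seq => k; rewrite ks_supp => /ks_pos /h1[e1 e2].
  by rewrite /sign_at; case: [exists _, _]; rewrite ?expr1 ?expr0.
rewrite prodEFin; congr EFin; rewrite (perm_big ks) /=; last first.
  by apply: uniq_perm => //; exact: fset_uniq.
by rewrite big_const_seq count_predT iter_mulr_1.
Qed.

Lemma sign_event_disjoint s s' w : sign_event s w -> sign_event s' w -> s = s'.
Proof.
move=> h h'; apply/ffunP => i.
have ik : nth 0%N ks i \in finsupp a by rewrite ks_supp mem_nth.
have e1 : eps (nth 0%N ks i) w = sign_at s (nth 0%N ks i) := h _ ik.
have e2 : eps (nth 0%N ks i) w = sign_at s' (nth 0%N ks i) := h' _ ik.
have : sign_at s (nth 0%N ks i) = sign_at s' (nth 0%N ks i) by rewrite -e1 -e2.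
rewrite !sign_at_nth.
by case: (s i); case: (s' i); rewrite ?expr1 ?expr0 //; lra.
Qed.

Definition grid_value (M : nat) (s : {ffun 'I_m -> bool}) (t : 'I_M.+1) : R :=
  cnorm (\sum_(i < m) ((-1) ^+ s i)%:C%C * (a (nth 0%N ks i) * char (nth 0%N ks i) (t%:R / M.+1%:R))).

Lemma grid_value_le M s w t : sign_event s w ->
  ((@grid_value M s t)%:E <= Lqnorm +oo
     (fun x => \sum_(k <- finsupp a) (eps k w)%:C%C * a k * char k x)%R)%E.
Proof.
move=> sw.
have -> : @grid_value M s t = cnorm (\sum_(k <- finsupp a) (eps k w)%:C%C * a k * char k (t%:R / M.+1%:R)).
  congr cnorm; rewrite [RHS](perm_big ks) /=; last first.
    by apply: uniq_perm => //; exact: fset_uniq.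
  rewrite (big_nth 0%N) big_mkord; apply: eq_bigr => i _; rewrite -mulrA; congr (_%:C%C * _).
  have := sw (nth 0%N ks i); rewrite /= ks_supp mem_nth // => ->//.
  by rewrite sign_at_nth.
apply: (@le_ess_sup_haar R (fun x => \sum_(k <- finsupp a) (eps k w)%:C%C * a k * char k x)).
  exact: (@continuous_cnorm_trig R (enum_fset (finsupp a)) (fun k => (eps k w)%:C%C * a k)).
by rewrite divr_ge0 //= ltr_pdivrMr ?ltr0n // mul1r ltr_nat.
Qed.

(** The sign events are disjoint, of probability [2^-1 ^+ m] each, so the average is the integral of
    the simple function [h], which lies below the sup norm at every [w]. *)
Lemma pisier_norm_ge (M : nat) :
  ((avg (fun s : {ffun 'I_m -> bool} => maxG (@grid_value M s)))%:E <= pisier_norm eps a)%E.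
Proof.
have mg0 s : 0 <= maxG (@grid_value M s).
  by apply: le_trans (le_maxG _ 0); exact: cnorm_ge0.
pose h w := (\sum_(s : {ffun 'I_m -> bool}) (maxG (@grid_value M s))%:E * (\1_(sign_event s) w)%:E)%E.
have -> : (avg (fun s : {ffun 'I_m -> bool} => maxG (@grid_value M s)))%:E = (\int[P]_w h w)%E.
  rewrite /h ge0_integral_sum //; last 2 first.
  - move=> s; apply: measurable_funeM; apply/measurable_EFinP.
    by apply: measurable_indic; exact: measurable_sign_event.
  - by move=> s w _; rewrite mule_ge0 // lee_fin.
  rewrite /avg mulr_sumr -sumEFin; apply: eq_bigr => s _.
  rewrite ge0_integralZl_EFin //; last first.
    apply/measurable_EFinP; apply: measurable_indic; exact: measurable_sign_event.
  rewrite integral_indic //; last exact: measurable_sign_event.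
  rewrite classical_sets.setIT [X in _ = (_ * X)%E]prob_sign_event -EFinM mulrC card_ffun card_bool card_ord.
  by rewrite natrX exprVn.
apply: ge0_le_integralT => w.
  by apply: sume_ge0 => s _; rewrite mule_ge0 // lee_fin.
have [[s sw]|ns] := pselect (exists s, sign_event s w); last first.
  rewrite /h big1 ?Lnorm_ge0 // => s _; rewrite indicE memNset ?mule0 // => sw.
  by apply: ns; exists s.
rewrite /h (bigD1 s) //= big1 ?adde0; last first.
  move=> s' s's; rewrite indicE memNset ?mule0 // => s'w.
  by rewrite (sign_event_disjoint s'w sw) eqxx in s's.
rewrite indicE mem_set // mule1.
have := fun t => @grid_value_le M s w t sw.
case: (Lqnorm _ _) => [v| |] hv; rewrite ?leey //; last by have := hv 0.
by rewrite lee_fin; apply: maxG_le => t; have := hv t; rewrite lee_fin.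
Qed.

End Pisier.

(** * Comparison of the signal with the random polynomial *)

Section ComplexBounds.
Context {R : realType}.
Local Notation cnorm := (@Normc.normc R).

Lemma Re_le_cnorm (z : R[i]) : `|complex.Re z| <= cnorm z.
Proof.
case: z => a b /=; rewrite -sqrtr_sqr ler_wsqrtr //.
by rewrite lerDl sqr_ge0.
Qed.

Lemma Im_le_cnorm (z : R[i]) : `|complex.Im z| <= cnorm z.
Proof.
case: z => a b /=; rewrite -sqrtr_sqr ler_wsqrtr //.
by rewrite lerDr sqr_ge0.
Qed.

Lemma cnorm_real (x : R) : cnorm x%:C%C = `|x|.
Proof. by rewrite /= expr0n addr0 sqrtr_sqr. Qed.

Lemma cnormZ (x : R) z : cnorm (x%:C%C * z) = `|x| * cnorm z.
Proof. by rewrite Normc.normcM cnorm_real. Qed.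

Lemma cnorm_char k (x : R) : cnorm (char k x) = 1.
Proof. by rewrite /= cos2Dsin2 sqrtr1. Qed.

End ComplexBounds.

(** * Normalised monomials on the cyclic grid *)

Section Characters.
Context {R : realType}.
Variables (a : coefs R) (ks : seq nat) (M : nat).
Hypothesis ks_supp : finsupp a =i ks.
Local Notation cnorm := (@Normc.normc R).
Local Notation m := (size ks).
Local Notation K := 'I_m.
Local Notation G := 'I_M.+1.

Definition freq (i : K) := nth 0%N ks i.
Definition modulus (i : K) : R := cnorm (a (freq i)).
Definition monomial (i : K) (t : G) : R[i] := a (freq i) * char (freq i) (t%:R / M.+1%:R).
Definition re_part i t := complex.Re (monomial i t) / modulus i.
Definition im_part i t := complex.Im (monomial i t) / modulus i.
Definition char_dist (i : K) (t : G) : R := 2 - 2 * cos (2 * pi * (freq i)%:R * (t%:R / M.+1%:R)).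

Lemma modulus_gt0 i : 0 < modulus i.
Proof.
rewrite lt_def cnorm_ge0 andbT; apply/negP => /eqP /Normc.eq0_normc e.
have : freq i \in finsupp a by rewrite ks_supp mem_nth.
by rewrite mem_finsupp e eqxx.
Qed.

Lemma cnorm_monomial i t : cnorm (monomial i t) = modulus i.
Proof. by rewrite Normc.normcM cnorm_char mulr1. Qed.

Lemma re_part_le1 i t : `|re_part i t| <= 1.
Proof.
rewrite /re_part normrM normfV (gtr0_norm (modulus_gt0 i)) ler_pdivrMr ?modulus_gt0 // mul1r.
by rewrite -(cnorm_monomial i t) Re_le_cnorm.
Qed.

Lemma im_part_le1 i t : `|im_part i t| <= 1.
Proof.
rewrite /im_part normrM normfV (gtr0_norm (modulus_gt0 i)) ler_pdivrMr ?modulus_gt0 // mul1r.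
by rewrite -(cnorm_monomial i t) Im_le_cnorm.
Qed.

(** Subtraction in ['I_M.+1] is modulo [M.+1], which shifts the argument of the cosine by an integer
    number of periods. *)
Lemma char_distB i (s t : G) :
  char_dist i (s - t) = 2 - 2 * cos (2 * pi * (freq i)%:R * (s%:R / M.+1%:R - t%:R / M.+1%:R)).
Proof.
congr (_ - _ * _).
pose r : G := s - t; rewrite -/r.
have e : (r + t = (r + t) %/ M.+1 * M.+1 + s)%N.
  rewrite [LHS](divn_eq _ M.+1); congr (_ + _)%N.
  by rewrite -[X in _ = nat_of_ord X](subrK t s).
set n := (_ %/ _)%N in e.
have {}e : r%:R = n%:R * M.+1%:R + s%:R - t%:R :> R.
  by rewrite -natrM -natrD -e natrD addrK.
have e' : (r%:R : R) / M.+1%:R = n%:R + (s%:R / M.+1%:R - t%:R / M.+1%:R).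
  by rewrite e !mulrDl mulfK ?pnatr_eq0 // mulNr addrA.
rewrite e' mulrDr addrC -[X in cos (_ + X)]mulrA -natrM.
by rewrite cosD cos2pin sin2pin mulr1 mulr0 subr0.
Qed.

(** The phase of the coefficient is a rotation and does not affect distances. *)
Lemma dist2_char_dist i s t : dist2 re_part im_part i s t = char_dist i (s - t).
Proof.
rewrite char_distB /dist2 /re_part /im_part /monomial /char.
have m0 := modulus_gt0 i.
have : modulus i ^+ 2 = complex.Re (a (freq i)) ^+ 2 + complex.Im (a (freq i)) ^+ 2.
  by rewrite /modulus; case: (a (freq i)) => u v; rewrite sqr_cnorm.
case: (a (freq i)) => u v /= muv.
rewrite mulrBr cosB.
set x := 2 * pi * _ * (s%:R / _); set y := 2 * pi * _ * (t%:R / _).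
have := cos2Dsin2 x; have := cos2Dsin2 y.
move: (cos x) (sin x) (cos y) (sin y) => cx sx cy sy hy hx.
rewrite -!mulrBl !exprMn -mulrDl exprVn muv.
have uv0 : u ^+ 2 + v ^+ 2 != 0 by rewrite -muv gt_eqF ?exprn_gt0.
apply: (mulIf uv0); rewrite divfK //.
have -> : (u * cx - v * sx - (u * cy - v * sy)) ^+ 2 + (u * sx + v * cx - (u * sy + v * cy)) ^+ 2
  = (u ^+ 2 + v ^+ 2) * ((cx ^+ 2 + sx ^+ 2) + (cy ^+ 2 + sy ^+ 2) - 2 * (cx * cy + sx * sy)) by ring.
by rewrite hx hy; ring.
Qed.

Definition sup_value (x : K -> R) : R :=
  maxG (fun t : G => cnorm (\sum_(i < m) (x i)%:C%C * monomial i t)).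

Lemma sup_value_convex (c : R) (x y : K -> R) : 0 <= c <= 1 ->
  sup_value (fun k => c * x k + (1 - c) * y k) <= c * sup_value x + (1 - c) * sup_value y.
Proof.
move=> /andP[c0 c1]; apply: maxG_le => t.
have -> : \sum_(i < m) (c * x i + (1 - c) * y i)%:C%C * monomial i t =
  c%:C%C * (\sum_(i < m) (x i)%:C%C * monomial i t) +
  (1 - c)%:C%C * (\sum_(i < m) (y i)%:C%C * monomial i t).
  rewrite !mulr_sumr -big_split; apply: eq_bigr => i _ /=.
  by rewrite rmorphD !rmorphM /= mulrDl !mulrA.
apply: le_trans (le_normcD _ _) _; rewrite !cnormZ (ger0_norm c0) ger0_norm ?subr_ge0 //.
by rewrite lerD // ler_wpM2l ?subr_ge0 //; exact: (le_maxG (fun t : G => cnorm _)).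
Qed.

Variables (lev : K -> nat) (b : nat -> R).
Hypothesis b_le : forall i, b (lev i) <= modulus i.
Hypothesis b0 : forall j, 0 <= b j.
Definition level_set j := [set i : K | lev i == j].

Lemma signal_levels (I : seq nat) w t : uniq I ->
  signal re_part im_part level_set b I w t =
  \sum_(i < m) (if lev i \in I then b (lev i) else 0) * coord re_part im_part w i t.
Proof.
move=> uI; rewrite /signal; under eq_bigr do rewrite mulr_sumr big_mkcond.
rewrite exchange_big; apply: eq_bigr => i _ /=.
case: ifP => [iI|/negbT iI].
  rewrite (bigD1_seq (lev i)) //= inE eqxx big1 ?addr0 // => j ji.
  by rewrite inE eq_sym (negbTE ji).
rewrite mul0r big_seq big1 // => j jI; rewrite inE.
by case: eqP => // e; rewrite e jI in iI.
Qed.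

(** The frequencies with [w.2] false enter through a real part, the others through an imaginary
    part. Each group is the random polynomial with multipliers in [0, 1], so contraction applies
    twice; hence the factor 2. *)
Lemma signal_le_sup_value (I : seq nat) : uniq I ->
  avg (fun w => maxG (signal re_part im_part level_set b I w)) <=
  2 * avg (fun s : {ffun K -> bool} => sup_value (fun k => (-1) ^+ s k)).
Proof.
move=> uI.
pose c i : R := if lev i \in I then b (lev i) else 0.
have c01 i : 0 <= c i / modulus i <= 1.
  rewrite divr_ge0 ?ler_pdivrMr ?modulus_gt0 ?mul1r ?(ltW (modulus_gt0 i)) //.
    by rewrite /c; case: ifP => // _; first [exact: b0|exact: b_le|exact: ltW (modulus_gt0 i)].
  by rewrite /c; case: ifP => // _; first [exact: b0|exact: b_le|exact: ltW (modulus_gt0 i)].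
pose theta (f : bool) (w : {ffun K -> bool * bool}) i : R := if (w i).2 == f then c i / modulus i else 0.
have th01 f w i : 0 <= theta f w i <= 1.
  by rewrite /theta; case: ifP => // _; rewrite lexx ler01.
have thflip f k w : theta f (flips k w) = theta f w.
  by apply/funext => i; rewrite /theta ffunE; case: (i == k).
have H f := sign_contraction sup_value_convex (th01 f) (thflip f).
have M1 := avg_marginal (fun s : {ffun K -> bool} => sup_value (fun k => (-1) ^+ s k)).
have {}M1 : avg (fun w : {ffun K -> bool * bool} => sup_value (fun k => (-1) ^+ (w k).1)) =
   avg (fun s : {ffun K -> bool} => sup_value (fun k => (-1) ^+ s k)).
  rewrite -M1; apply: eq_avg => w; congr sup_value; apply/funext => k; by rewrite ffunE.
rewrite mulr2n mulrDl !mul1r -M1; apply: le_trans (lerD (H false) (H true)).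
rewrite -avgD; apply: avg_le => w; apply: maxG_le => t.
rewrite signal_levels //.
have -> : \sum_(i < m) (if lev i \in I then b (lev i) else 0) * coord re_part im_part w i t =
  complex.Re (\sum_(i < m) ((-1) ^+ (w i).1 * theta false w i)%:C%C * monomial i t) +
  complex.Im (\sum_(i < m) ((-1) ^+ (w i).1 * theta true w i)%:C%C * monomial i t).
  rewrite !raddf_sum -big_split; apply: eq_bigr => i _ /=.
  rewrite -/(c i) /coord /signed_part /theta /re_part /im_part.
  have := gt_eqF (modulus_gt0 i).
  case: (monomial i t) => u v; case: (w i) => s [] /= m0; move: ((-1) ^+ s) => e;
    by field; rewrite m0.
apply: lerD; first by apply: le_trans (le_maxG _ t); apply: le_trans (ler_norm _) _; exact: Re_le_cnorm.
by apply: le_trans (le_maxG _ t); apply: le_trans (ler_norm _) _; exact: Im_le_cnorm.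
Qed.

End Characters.

(** * Summation over the blocks *)

Section BlockEntropy.
Context {R : realType}.
Variables (L : set nat) (C alpha : R).
Hypothesis C0 : 0 < C.
Hypothesis hLq : forall (q : R) (a : coefs R), 2 < q -> spectrum_in L a ->
  (Lqnorm q%:E (trigpoly a) <= (C * q `^ alpha)%:E * Lqnorm 2%:E (trigpoly a))%E.
Local Notation cnorm := (@Normc.normc R).
Variables (ks : seq nat) (M : nat).
Hypothesis ks_uniq : uniq ks.
Hypothesis ks_L : forall k, k \in ks -> L k.
Local Notation K := 'I_(size ks).

(** On the ball the real part of the sum of the characters is at least [n / 2]. Markov's inequality
    for the 2s-th moment bounds the proportion of such points by [(B / (n / 2)) ^+ (2 * s)], and the
    size condition makes this ratio at most [expR (-1)]. *)
Lemma block_entropy (A : {set K}) (s mx : nat) : (0 < #|A|)%N -> (1 < s)%N ->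
  (forall k, k \in ks -> (k < mx)%N) -> (s * mx <= M)%N ->
  2 * C * (2 * s)%:R `^ alpha <= Num.sqrt #|A|%:R * expR (-1) ->
  #|[set t : 'I_M.+1 | dset (@char_dist R ks M) A t <= #|A|%:R]|%:R <=
    expR (- (2 * s)%:R) * #|{: 'I_M.+1}|%:R :> R.
Proof.
move=> A0 s1 ksm sM hs; rewrite card_ord.
set n : R := #|A|%:R; have n0 : 0 < n by rewrite ltr0n.
pose F := seq_fset tt [seq freq i | i <- enum A].
have uF : uniq [seq freq i | i <- enum A].
  rewrite map_inj_uniq ?enum_uniq // => i j /eqP; rewrite nth_uniq // => /eqP; exact: val_inj.
have FA : perm_eq F [seq freq i | i <- enum A].
  by apply: uniq_perm => // k; rewrite seq_fsetE.
have cF : #|` F| = #|A| by rewrite size_seq_fset undup_id // size_map -cardE.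
have Fks k : k \in F -> k \in ks.
  by rewrite seq_fsetE => /mapP[i _ ->]; exact: mem_nth.
have [FL Fm] : ([set` F] `<=` L)%classic /\ forall k, k \in F -> (k < mx)%N.
  by split=> [k /= /Fks /ks_L //|k /Fks /ksm].
have := moment_bound hLq FL s1 Fm (sM : (s * mx < M.+1)%N); rewrite cF -/n.
set B := C * _ * _ => hB.
have big_on_ball t : dset (@char_dist R ks M) A t <= n ->
   (n / 2) ^+ (2 * s) <= cnorm (\sum_(k <- F) char k (t%:R / M.+1%:R)) ^+ (2 * s).
  move=> ht; rewrite lerXn2r ?nnegrE ?cnorm_ge0 ?divr_ge0 ?(ltW n0) //.
  apply: le_trans (Re_le_cnorm _); apply: le_trans (ler_norm _).
  rewrite (perm_big _ FA) /= big_map big_enum /= raddf_sum /=.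
  move: ht; rewrite /dset /char_dist sumrB sumr_const -mulr_sumr -[2 *+ _]mulr_natr -/n.
  by set x := \sum_(i in A) _; lra.
have cardB : #|[set t : 'I_M.+1 | dset (@char_dist R ks M) A t <= n]|%:R * (n / 2) ^+ (2 * s) <=
   M.+1%:R * B ^+ (2 * s).
  apply: le_trans hB; rewrite mulr_natl -sumr_const.
  rewrite big_mkcond; apply: ler_sum => t _; rewrite inE; case: ifP => [/big_on_ball//|_].
  by rewrite exprn_ge0 // cnorm_ge0.
have sn : Num.sqrt n ^+ 2 = n by rewrite sqr_sqrtr // ltW.
have sn0 : 0 < Num.sqrt n by rewrite sqrtr_gt0.
have Bn : B <= n / 2 * expR (-1).
  rewrite /B -[n in n / 2]sn expr2.
  have := ler_wpM2r (ltW sn0) hs; lra.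
have B0 : 0 <= B by rewrite !mulr_ge0 ?(ltW C0) ?powR_ge0 ?sqrtr_ge0.
rewrite -(ler_pM2r (exprn_gt0 (2 * s) (divr_gt0 n0 (ltr0Sn R 1)))).
apply: le_trans cardB _.
have -> : expR (- (2 * s)%:R) = expR (-1) ^+ (2 * s) :> R by rewrite -expRM_natl mulrN1.
rewrite mulrAC [X in _ <= X]mulrC; apply: ler_wpM2l => //.
rewrite -exprMn mulrC lerXn2r ?nnegrE //; first by rewrite mulr_ge0 ?expR_ge0 ?divr_ge0 ?ltW.
Qed.

End BlockEntropy.

Section Condensation.
Context {R : realType}.

Lemma condensation (x : nat -> R) J : (forall i j, (i <= j)%N -> x j <= x i) ->
  \sum_(0 <= i < (2 ^ J).-1) x i <= \sum_(0 <= j < J) 2 ^+ j * x (2 ^ j).-1.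
Proof.
move=> xm; elim: J => [|J IH]; first by rewrite !big_geq.
have P2 : (0 < 2 ^ J)%N by rewrite expn_gt0.
have le1 : ((2 ^ J).-1 <= (2 ^ J.+1).-1)%N by rewrite expnS; lia.
rewrite (@big_cat_nat _ _ _ (2 ^ J).-1) //= big_nat_recr //= lerD //.
apply: (@le_trans _ _ (\sum_((2 ^ J).-1 <= i < (2 ^ J.+1).-1) x (2 ^ J).-1)).
  by apply: ler_sum_nat => i /andP[h _]; exact: xm.
rewrite sumr_const_nat -[X in X <= _]mulr_natl -natrX.
have -> : ((2 ^ J.+1).-1 - (2 ^ J).-1 = 2 ^ J)%N by rewrite expnS; lia.
by [].
Qed.

Lemma sum_powR_le (p : R) (I : Type) (s : seq I) (y : I -> R) : 1 <= p -> (forall i, 0 <= y i) ->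
  \sum_(i <- s) y i `^ p <= (\sum_(i <- s) y i) `^ p.
Proof.
move=> p1 y0; elim: s => [|i s IH]; first by rewrite !big_nil powR_ge0.
rewrite !big_cons; set Y := \sum_(j <- s) y j in IH *.
have Y0 : 0 <= Y by apply: sumr_ge0.
apply: (@le_trans _ _ (y i `^ p + Y `^ p)); first by rewrite lerD2l.
have split_pow (u : R) : 0 <= u -> u `^ p = u * u `^ (p - 1).
  move=> u0; have [->|un0] := eqVneq u 0; first by rewrite mul0r powR0 // gt_eqF //; lra.
  rewrite -[u in u * _]powRr1 // -powRD; first by congr (_ `^ _); lra.
  by rewrite un0 implybT.
rewrite !split_pow ?addr_ge0 // mulrDl.
have pm : 0 <= p - 1 by lra.
by rewrite lerD // ler_wpM2l // ge0_ler_powR // ?nnegrE ?addr_ge0 // ?lerDl ?lerDr.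
Qed.

Lemma geometric_unbounded (q B c : R) : 1 < q -> 0 < c -> exists j0, forall j, (j0 <= j)%N ->
  B <= c * q ^+ j.
Proof.
move=> q1 c0.
have bern j : 1 + j%:R * (q - 1) <= q ^+ j.
  elim: j => [|j IH]; first by rewrite mul0r addr0 expr0.
  rewrite exprS -natr1.
  have : q * (1 + j%:R * (q - 1)) <= q * q ^+ j by rewrite ler_wpM2l //; lra.
  have : 0 <= j%:R * (q - 1) * (q - 1) by rewrite !mulr_ge0 //; lra.
  by lra.
exists (Num.truncn (`|B| / (c * (q - 1)))).+1 => j jj.
have d0 : 0 < c * (q - 1) by rewrite mulr_gt0 // subr_gt0.
apply: le_trans (ler_wpM2l (ltW c0) (bern j)).
have : `|B| / (c * (q - 1)) <= j%:R.
  have /andP[_ /ltW h] := truncn_itv (divr_ge0 (normr_ge0 B) (ltW d0)).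
  by apply: le_trans h _; rewrite ler_nat.
rewrite ler_pdivrMr //; have := ler_norm B; nra.
Qed.

End Condensation.

(** * Parameters and conclusion *)

Section Rider.
Context {R : realType} (d : measure_display) (T : measurableType d) (P : probability T R).
Variable eps : nat -> {RV P >-> R}.
Hypothesis heps : rademacher eps.
Variables (L : set nat) (C alpha : R).
Hypothesis hL : (L `<=` [set k | (0 < k)%N])%classic.
Hypothesis C0 : 0 < C.
Hypothesis halpha : 2^-1 <= alpha.
Hypothesis hLq : forall (q : R) (a : coefs R), 2 < q -> spectrum_in L a ->
  (Lqnorm q%:E (trigpoly a) <= (C * q `^ alpha)%:E * Lqnorm 2%:E (trigpoly a))%E.
Local Notation cnorm := (@Normc.normc R).

(** The constants make g_j = [(c0 * q0 ^+ j) ^+ 4] satisfy 2 C (2 g_j)^alpha = 2^(j/2) / e, the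
    borderline case of [block_entropy]; fourth roots are taken for the greedy selection. *)
Let kappa : R := (2 * C * expR 1) `^ (- alpha^-1).
Let q0 : R := 2 `^ (8 * alpha)^-1.
Let c0 : R := (kappa / 2) `^ 4^-1.

Lemma alpha_gt0 : 0 < alpha.
Proof. by have := halpha; lra. Qed.

Lemma kappa_gt0 : 0 < kappa.
Proof. by rewrite powR_gt0 // !mulr_gt0 ?expR_gt0. Qed.

Lemma c0_gt0 : 0 < c0.
Proof. by rewrite powR_gt0 // divr_gt0 // kappa_gt0. Qed.

Lemma q0_gt1 : 1 < q0.
Proof.
have e0 : 0 < (8 * alpha)^-1 by rewrite invr_gt0 mulr_gt0 ?alpha_gt0.
have : 1 `^ (8 * alpha)^-1 < q0 by rewrite gt0_ltr_powR ?nnegrE // ltr1n.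
by rewrite powR1.
Qed.

Lemma entropy_size j : (c0 * q0 ^+ j) ^+ 4 = kappa / 2 * 2 `^ (j%:R / (2 * alpha)).
Proof.
have a0 := alpha_gt0.
rewrite exprMn; congr (_ * _).
  rewrite -powR_mulrn ?powR_ge0 // -powRrM mulVf ?powRr1 //.
  by rewrite divr_ge0 // ltW // kappa_gt0.
rewrite -exprM -powR_mulrn ?powR_ge0 // -powRrM natrM; congr (_ `^ _).
by field; rewrite gt_eqF.
Qed.

Lemma entropy_size_alpha j :
  2 * C * (2 * (c0 * q0 ^+ j) ^+ 4) `^ alpha = Num.sqrt (2 ^+ j) * expR (-1).
Proof.
have a0 := alpha_gt0; rewrite entropy_size.
have -> : 2 * (kappa / 2 * 2 `^ (j%:R / (2 * alpha))) = kappa * 2 `^ (j%:R / (2 * alpha)) by lra.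
rewrite powRM ?powR_ge0 // -!powRrM mulNr mulVf ?gt_eqF // powR_inv1; last first.
  by rewrite !mulr_ge0 ?expR_ge0 // ltW.
have -> : j%:R / (2 * alpha) * alpha = j%:R * 2^-1 by field; rewrite gt_eqF.
rewrite powRrM powR_mulrn // powR12_sqrt ?exprn_ge0 // expRN.
by field; rewrite !gt_eqF ?expR_gt0.
Qed.

Lemma weight_size j : Num.sqrt (2 ^+ j) * (c0 * q0 ^+ j) ^+ 2 =
  c0 ^+ 2 * 2 `^ (j%:R * ((2 * alpha + 1) / (4 * alpha))).
Proof.
have a0 := alpha_gt0.
rewrite exprMn mulrCA; congr (_ * _).
rewrite -powR12_sqrt ?exprn_ge0 // -exprM -!powR_mulrn ?powR_ge0 // -!powRrM natrM -powRD ?pnatr_eq0 ?implybT //.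
by congr (_ `^ _); field; rewrite gt_eqF.
Qed.

Section Polynomial.
Variable a : coefs R.
Hypothesis aL : spectrum_in L a.

Let ks := sort (fun k l => cnorm (a l) <= cnorm (a k)) (finsupp a).
Let m := size ks.
Let decr i : R := cnorm (a (nth 0%N ks i)).
(** Level [j] occupies the positions from 2^j - 1 to 2^(j+1) - 2 in the decreasing order. The weight
    [b j] below is read just after its last position, hence bounds its moduli from below. *)
Let lev (i : 'I_m) := trunc_log 2 i.+1.
Let b j : R := decr (2 ^ j.+1).-1.

Lemma freqs_uniq : uniq ks.
Proof. by rewrite sort_uniq fset_uniq. Qed.

Lemma freqs_supp : finsupp a =i ks.
Proof. by move=> k; rewrite mem_sort. Qed.

Lemma freqs_L k : k \in ks -> L k.
Proof. by rewrite -freqs_supp => ka; exact: aL. Qed.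

Lemma freqs_pos k : k \in ks -> (0 < k)%N.
Proof. by move/freqs_L/hL. Qed.

Lemma decr_default i : (m <= i)%N -> decr i = 0.
Proof.
(* The default frequency 0 lies outside the spectrum, which is positive, so its coefficient is 0. *)
move=> mi; rewrite /decr nth_default // (_ : a 0%N = 0) ?Normc.normc0 //.
have [/freqs_pos//|] := boolP (0%N \in ks).
by rewrite -freqs_supp mem_finsupp negbK => /eqP.
Qed.

Lemma decr_mono i j : (i <= j)%N -> decr j <= decr i.
Proof.
move=> ij; have [jm|mj] := ltnP j m; last by rewrite decr_default ?cnorm_ge0.
have tr : transitive (fun k l => cnorm (a l) <= cnorm (a k)).
  by move=> x y z h1 h2; exact: le_trans h2 h1.
have srt : sorted (fun k l => cnorm (a l) <= cnorm (a k)) ks.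
  by apply: sort_sorted => x y; exact: le_total.
exact: (sorted_leq_nth tr (fun x => lexx _) 0%N srt i j (leq_ltn_trans ij jm) jm ij).
Qed.

Lemma level_coef_le i : b (lev i) <= decr i.
Proof.
apply: decr_mono; rewrite -ltnS prednK ?expn_gt0 //.
by apply: ltnW; exact: trunc_log_ltn.
Qed.

Lemma level_card j : (2 ^ j.+1 <= m)%N -> (2 ^ j <= #|level_set lev j|)%N.
Proof.
move=> jm; have h (i : 'I_(2 ^ j)) : ((2 ^ j).-1 + i < m)%N.
  apply: leq_trans jm; have := ltn_ord i; have : (0 < 2 ^ j)%N by rewrite expn_gt0.
  by rewrite expnS; lia.
pose f (i : 'I_(2 ^ j)) : 'I_m := Ordinal (h i).
have fI : injective f by move=> i i' /(congr1 val) /= /addnI /val_inj.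
rewrite -{1}(card_ord (2 ^ j)) -cardsT -(card_imset _ fI).
apply/subset_leq_card/fintype.subsetP => _ /imsetP[i _ ->]; rewrite inE /lev /=.
apply/eqP; apply: trunc_log_eq => //.
have := ltn_ord i; have : (0 < 2 ^ j)%N by rewrite expn_gt0.
by rewrite expnS; lia.
Qed.

Variable j0 : nat.
Hypothesis hj0 : forall j, (j0 <= j)%N -> 6 <= (c0 * q0 ^+ j) ^+ 4.
Let J := [seq j <- iota 0 m | (j0 <= j)%N && (2 ^ j.+1 <= m)%N].
Let mx := (\max_(k <- ks) k).+1.
Let trunc_entropy j := Num.truncn ((c0 * q0 ^+ j) ^+ 4).
(** One grid fine enough for every level: [M] dominates [trunc_entropy j * mx] for each [j < m]. *)
Let M := ((\sum_(j < m) trunc_entropy j) * mx)%N.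
Let B := avg (fun s : {ffun 'I_m -> bool} => @sup_value R a ks M (fun k => (-1) ^+ s k)).

Lemma sup_value_le_pisier : (B%:E <= pisier_norm eps a)%E.
Proof. exact: (pisier_norm_ge heps freqs_uniq freqs_supp freqs_pos M). Qed.

Lemma sup_value_ge0 (x : 'I_m -> R) : 0 <= @sup_value R a ks M x.
Proof. by apply: le_trans (le_maxG _ 0); exact: cnorm_ge0. Qed.

(** Contraction with multiplier 1 at the first position and 0 elsewhere. *)
Lemma largest_coef_le : decr 0 <= B.
Proof.
have [m0|m0] := posnP m.
  by rewrite decr_default ?m0 //; apply: avg_ge0 => s; exact: sup_value_ge0.
pose i0 : 'I_m := Ordinal m0.
have th (w : {ffun 'I_m -> bool * bool}) (k : 'I_m) : 0 <= ((k == i0)%:R : R) <= 1.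
  by case: (k == i0); rewrite ?lexx ?ler01.
have := sign_contraction (@sup_value_convex R a ks M) th (fun k w => erefl).
have := avg_marginal (fun s : {ffun 'I_m -> bool} => @sup_value R a ks M (fun k => (-1) ^+ s k)).
rewrite -/B => <-.
rewrite [leRHS](_ : _ = avg (fun w : {ffun 'I_m -> bool * bool} =>
   @sup_value R a ks M (fun k => (-1) ^+ [ffun k => (w k).1] k))); last first.
  by apply: eq_avg => w; congr sup_value; apply/funext => k; rewrite ffunE.
apply: le_trans.
have O0 : (0 < #|{: {ffun 'I_m -> bool * bool}}|)%N.
  by apply/card_gt0P; exists [ffun=> (true, true)].
rewrite -[leLHS](avg_cst _ O0); apply: avg_le => w.
apply: le_trans (le_maxG _ 0).
rewrite (bigD1 i0) //= big1 ?addr0; last first.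
  by move=> k /negbTE ->; rewrite mulr0 rmorph0 mul0r.
by rewrite mulr1 cnormZ normr_sign mul1r cnorm_monomial.
Qed.

Lemma weighted_sum_le : \sum_(j <- J) 2 `^ (j%:R * ((2 * alpha + 1) / (4 * alpha))) * b j <=
  2 * (24 * 128 * 4 ^+ 20 * (q0 / (q0 - 1))) / c0 ^+ 2 * B.
Proof.
have uJ : uniq J by rewrite filter_uniq // iota_uniq.
have memJ j : j \in J -> [/\ (j0 <= j)%N, (2 ^ j.+1 <= m)%N & (j < m)%N].
  by rewrite mem_filter mem_iota add0n => /andP[/andP[? ?] /andP[_ ?]].
have b_ge0 j : 0 <= b j by exact: cnorm_ge0.
have disj i j : i != j -> [disjoint level_set lev i & level_set lev j].
  move=> ij; rewrite -setI_eq0; apply/eqP/setP => k; rewrite !inE.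
  by apply/negP => /andP[/eqP-> /eqP e]; rewrite e eqxx in ij.
have [j jJ|I uI [IJ HI]] := @block_sum_le R 'I_M.+1 'I_m (@re_part R a ks M) (@im_part R a ks M)
    (@char_dist R ks M) (re_part_le1 freqs_supp) (im_part_le1 freqs_supp)
    (dist2_char_dist freqs_supp) (level_set lev) b disj b_ge0 q0 c0 J q0_gt1 c0_gt0 uJ.
  have [jj jm jm'] := memJ _ jJ; have g6 := hj0 jj; have lc := level_card jm.
  set g := _ ^+ 4 in g6 *; have g0 : 0 <= g by lra.
  have gg0 : 0 <= 2 * g by lra.
  have /andP[t1 t2] := truncn_itv g0; rewrite -/(trunc_entropy j) in t1 t2.
  have s6 : (6 <= trunc_entropy j)%N.
    by have : 6%:R < (trunc_entropy j).+1%:R :> R := le_lt_trans g6 t2; rewrite ltr_nat ltnS.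
  split=> //; first by apply: leq_trans lc; rewrite expn_gt0.
  (* With [s] the integer part of [g], [2 * s <= 2 * g] gives the size condition, while
     [g < s + 1 <= 2 * s] returns the bound with [g]. *)
  apply: (@le_trans _ _ (expR (- (2 * trunc_entropy j)%:R) * #|{: 'I_M.+1}|%:R)).
    apply: (block_entropy C0 hLq freqs_uniq freqs_L (mx := mx)).
    - by apply: leq_trans lc; rewrite expn_gt0.
    - by apply: leq_trans s6.
    - by move=> k kks; rewrite ltnS; exact: leq_bigmax_seq.
    - by rewrite leq_mul2r; apply/orP; right; rewrite (bigD1 (Ordinal jm')) //= leq_addr.
    apply: (@le_trans _ _ (2 * C * (2 * g) `^ alpha)).
      rewrite ler_wpM2l ?mulr_ge0 ?(ltW C0) // ge0_ler_powR ?nnegrE ?(ltW alpha_gt0) //.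
      by rewrite natrM ler_wpM2l.
    rewrite entropy_size_alpha ler_wpM2r ?expR_ge0 // ler_wsqrtr // -natrX ler_nat.
    exact: lc.
  rewrite ler_wpM2r // ler_expR lerN2 natrM.
  have : 1 <= (trunc_entropy j)%:R :> R by rewrite ler1n (leq_trans _ s6).
  by move: t2; rewrite -natr1; lra.
have {}HI := le_trans HI (ler_wpM2l _ (signal_le_sup_value M freqs_supp level_coef_le b_ge0 uI)).
have D0 : 0 < c0 ^+ 2 by rewrite exprn_gt0 // c0_gt0.
have -> : 2 * (24 * 128 * 4 ^+ 20 * (q0 / (q0 - 1))) / c0 ^+ 2 * B =
  24 * 128 * 4 ^+ 20 * (q0 / (q0 - 1)) * (2 * B) / c0 ^+ 2 by ring.
rewrite ler_pdivlMr //; apply: le_trans (HI _); last first.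
  by rewrite !mulr_ge0 ?exprn_ge0 ?invr_ge0 //; have := q0_gt1; lra.
rewrite mulr_suml big_seq [X in _ <= X]big_seq; apply: ler_sum => j jJ.
have [_ jm _] := memJ _ jJ.
rewrite [_ `^ _ * b j]mulrC -mulrA [_ `^ _ * _]mulrC -weight_size ler_wpM2l // ler_wpM2r ?sqr_ge0 // ler_wsqrtr //.
by rewrite -natrX ler_nat level_card.
Qed.

Let p := 4 * alpha / (2 * alpha + 1).

(** After condensation, the levels up to [j0] are controlled by the largest coefficient alone, and
    the others by [weighted_sum_le], the l^p norm being at most the l^1 norm. *)
Lemma rider_bound : (\sum_(k <- finsupp a) cnorm (a k) `^ p) `^ p^-1 <=
  (2 ^+ j0.+1 + 2 * (2 * (24 * 128 * 4 ^+ 20 * (q0 / (q0 - 1))) / c0 ^+ 2) `^ p) `^ p^-1 * B.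
Proof.
have al := alpha_gt0.
have pV : p^-1 = (2 * alpha + 1) / (4 * alpha) by rewrite /p invf_div.
have p1 : 1 <= p by rewrite /p ler_pdivlMr; have := halpha; lra.
have p0 : 0 < p by lra.
have B0 : 0 <= B by apply: avg_ge0 => s; exact: sup_value_ge0.
set D1 := _ / c0 ^+ 2.
have D10 : 0 <= D1.
  by rewrite !mulr_ge0 ?invr_ge0 ?exprn_ge0 ?(ltW c0_gt0) //; have := q0_gt1; lra.
set E := _ + _; have E0 : 0 <= E by rewrite addr_ge0 ?mulr_ge0 ?powR_ge0 ?exprn_ge0.
suff : \sum_(k <- finsupp a) cnorm (a k) `^ p <= E * B `^ p.
  move=> h; apply: le_trans (ge0_ler_powR _ _ _ h) _.
  - by rewrite invr_ge0 ltW.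
  - by rewrite nnegrE sumr_ge0 // => k _; exact: powR_ge0.
  - by rewrite nnegrE mulr_ge0 ?powR_ge0.
  by rewrite powRM ?powR_ge0 // -(powRrM B) divff ?gt_eqF // powRr1.
pose x i := decr i `^ p.
have xm i j : (i <= j)%N -> x j <= x i.
  by move=> ij; rewrite ge0_ler_powR ?nnegrE ?cnorm_ge0 ?(ltW p0) // decr_mono.
have x0 i : 0 <= x i by exact: powR_ge0.
have -> : \sum_(k <- finsupp a) cnorm (a k) `^ p = \sum_(0 <= i < m) x i.
  rewrite (perm_big ks) /=; last by rewrite perm_sym perm_sort perm_refl.
  by rewrite (big_nth 0%N).
have mM : (m <= (2 ^ m).-1)%N by have := ltn_expl m (isT : (1 < 2)%N); lia.
apply: (@le_trans _ _ (\sum_(0 <= i < (2 ^ m).-1) x i)).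
  by rewrite [leRHS](big_cat_nat (n := m)) //= lerDl sumr_ge0.
apply: le_trans (condensation m xm) _.
have decr0 : x 0%N <= B `^ p.
  by rewrite ge0_ler_powR ?nnegrE ?cnorm_ge0 ?(ltW p0) // largest_coef_le.
have small : \sum_(0 <= j < m | (j <= j0)%N) 2 ^+ j * x (2 ^ j).-1 <= 2 ^+ j0.+1 * B `^ p.
  apply: (@le_trans _ _ (\sum_(0 <= j < m | (j <= j0)%N) 2 ^+ j * B `^ p)).
    by apply: ler_sum => j _; rewrite ler_wpM2l ?exprn_ge0 // (le_trans _ decr0) // xm.
  rewrite -mulr_suml ler_wpM2r ?powR_ge0 //.
  have := @geometric_below R 2 1 (2 ^+ j0) m (ltr1n R 2) ltr01 (exprn_ge0 _ (ler0n R 2)).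
  rewrite -(big_mkord (fun j => 1 * 2 ^+ j <= 2 ^+ j0) (fun j => 1 * 2 ^+ j)) => h.
  have -> : 2 ^+ j0.+1 = 2 ^+ j0 * (2 / (2 - 1)) :> R by rewrite exprS; field.
  apply: le_trans h; rewrite le_eqVlt; apply/orP; left; apply/eqP.
  by apply: eq_big => j; rewrite mul1r // ler_eXn2l // ltr1n.
have large : \sum_(0 <= j < m | ~~ (j <= j0)%N) 2 ^+ j * x (2 ^ j).-1 <= 2 * D1 `^ p * B `^ p.
  pose y j := 2 `^ (j%:R * p^-1) * b j.
  have yp j : y j `^ p = 2 ^+ j * x (2 ^ j.+1).-1.
    rewrite powRM ?powR_ge0 ?cnorm_ge0 // -(powRrM 2) -mulrA mulVf ?gt_eqF // mulr1.
    by rewrite powR_mulrn.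
  have y0 j : 0 <= y j by rewrite mulr_ge0 ?powR_ge0 ?cnorm_ge0.
  apply: (@le_trans _ _ (2 * \sum_(j <- J) y j `^ p)); last first.
    rewrite -mulrA ler_wpM2l // -powRM //.
    apply: le_trans (sum_powR_le J p1 y0) _.
    apply: (ge0_ler_powR (ltW p0)); first by rewrite nnegrE sumr_ge0.
      by rewrite nnegrE mulr_ge0.
    apply: le_trans weighted_sum_le; rewrite le_eqVlt; apply/orP; left; apply/eqP.
    by apply: eq_bigr => j _; rewrite /y pV.
  have -> : J = [seq j <- index_iota 0 m | (j0 <= j)%N && (2 ^ j.+1 <= m)%N].
    by rewrite /index_iota subn0.
  rewrite big_filter mulr_sumr big_mkcond [leRHS]big_mkcond /=.
  pose G j : R := if ~~ (j <= j0)%N then 2 ^+ j * x (2 ^ j).-1 else 0.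
  have G0 j : 0 <= G j by rewrite /G; case: ifP => // _; rewrite mulr_ge0 ?exprn_ge0.
  apply: (@le_trans _ _ (\sum_(0 <= j < m.+1) G j)).
    by rewrite big_nat_recr //= lerDl.
  (* The shift by one matches term [j.+1] of the condensed sum with level [j], whose weight [b j] is
     read at position 2^(j+1) - 1; this produces the factor 2. *)
  rewrite big_nat_recl // {1}/G leq0n add0r; apply: ler_sum => j _.
  rewrite /G -ltnNge ltnS yp; case: leqP => //= jj; case: leqP => [_|mj].
    by rewrite exprS mulrA.
  (* Here 2^(j+1) exceeds the number of frequencies, so that position is past the end of the
     list. *)
  by rewrite /x decr_default ?powR0 ?mulr0 ?gt_eqF //; lia.
by rewrite (bigID (fun j => j <= j0)%N) /= mulrDl lerD.
Qed.

End Polynomial.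

(** The constant of [rider_bound] involves [C], [alpha] and [j0], but not the polynomial. *)
Lemma rider_exponent : rider eps (4 * alpha / (2 * alpha + 1)) L.
Proof.
have q41 : 1 < q0 ^+ 4 by rewrite exprn_egt1 // q0_gt1.
have [j0 hj0] := @geometric_unbounded R (q0 ^+ 4) 6 (c0 ^+ 4) q41 (exprn_gt0 4 c0_gt0).
have {}hj0 j : (j0 <= j)%N -> 6 <= (c0 * q0 ^+ j) ^+ 4.
  by move=> /hj0; rewrite (exprMn _ c0) -(exprM q0 4) mulnC exprM.
eexists => a aL; have := rider_bound aL hj0; rewrite -lee_fin => /le_trans; apply.
rewrite EFinM; apply: lee_wpmul2l; last exact: sup_value_le_pisier.
by rewrite lee_fin powR_ge0.
Qed.

End Rider.

Unset Implicit Arguments.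
Set Strict Implicit.
Set Printing Implicit Defensive.
Local Open Scope classical_set_scope.
Local Open Scope ring_scope.

Theorem theorem4p9 (R : realType) (d : measure_display) (T : measurableType d)
    (P : probability T R) (eps : nat -> {RV P >-> R})
    (heps : rademacher eps)
    (L : set nat) (hL : L `<=` [set k | (0 < k)%N])
    (C alpha : R) (hC : 0 < C) (halpha : 2^-1 <= alpha)
    (hLq : forall (q : R) (a : coefs R), 2 < q -> spectrum_in L a ->
      (Lqnorm q%:E (trigpoly a)
         <= (C * q `^ alpha)%:E * Lqnorm 2%:E (trigpoly a))%E) :
  rider eps (4 * alpha / (2 * alpha + 1)) L.
Proof. exact (rider_exponent heps hL hC halpha hLq). Qed.
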